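(* There is a real number $\varepsilon > 0$ such that for every odd integer $n \geq 3$ and every real $\rho$ with $0 < \rho < \varepsilon$ the following holds. If $C \subset \mathbb{S}^2$ is a disk of radius $\rho$, and $P$ is a simple $n$-gon contained in $C$, then there is an isosceles triangle inscribed in $C$, whose three sides have lengths $\alpha, \beta, \beta$ with $\alpha \geq \beta$, such that $\operatorname{perim} P \leq (n-2)\alpha + 2\beta$.
   Context: $\mathbb{S}^2$ is the unit sphere with its spherical (geodesic) distance. A disk of radius $\rho$ in $\mathbb{S}^2$ is a closed metric ball of radius $\rho$ for this distance. Segments joining non-antipodal points are the shortest great-circle arcs. A simple $n$-gon is a polygon with $n$ edges (such segments), with each vertex belonging to exactly two edges and every other point belonging to at most one edge. $\operatorname{perim} P$ denotes the perimeter of $P$, i.e. the sum of the lengths of its edges. A triangle is inscribed in $C$ if its three vertices lie on the boundary of $C$; its side-lengths are spherical distances. *)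

(* Defs.v *)
From HB Require Import structures.
From mathcomp Require Import all_boot all_order all_algebra.
From mathcomp Require Import all_classical all_reals all_analysis.

Set Implicit Arguments.
Unset Strict Implicit.
Unset Printing Implicit Defensive.

Import Order.TTheory GRing.Theory Num.Theory.
Import numFieldNormedType.Exports.

Local Open Scope classical_set_scope.
Local Open Scope ring_scope.

Definition dot (R : realType) (x y : 'rV[R]_3) : R :=
  \sum_(i < 3) x 0 i * y 0 i.

Definition S2 (R : realType) : set 'rV[R]_3 := [set x | dot x x = 1].

(* Geodesic distance; only meaningful for x and y on the sphere. *)
Definition sdist (R : realType) (x y : 'rV[R]_3) : R := acos (dot x y).

Definition disk (R : realType) (c : 'rV[R]_3) (rho : R) : set 'rV[R]_3 :=
  [set x | S2 x /\ sdist c x <= rho].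

(* Topological boundary relative to the sphere. The closures are taken in the
   ambient space; as the sphere is closed, they agree with the closures for
   the subspace topology of the sphere. *)
Definition sboundary (R : realType) (C : set 'rV[R]_3) : set 'rV[R]_3 :=
  closure C `&` closure (@S2 R `\` C).

(* Part of the sphere in the convex cone spanned by x and y: for distinct
   non-antipodal x and y, this is the shortest great-circle arc joining them. *)
Definition segment (R : realType) (x y : 'rV[R]_3) : set 'rV[R]_3 :=
  [set z | S2 z /\ exists s t : R, [/\ 0 <= s, 0 <= t & z = s *: x + t *: y]].

(* A polygon with n edges is given by the cyclic sequence v of its vertices;
   ordS is the cyclic successor on 'I_n. *)
Definition edge (R : realType) (n : nat) (v : 'I_n -> 'rV[R]_3) (i : 'I_n) :
  set 'rV[R]_3 := segment (v i) (v (ordS i)).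

Definition polygon (R : realType) (n : nat) (v : 'I_n -> 'rV[R]_3) : Prop :=
  forall i, S2 (v i) /\ v (ordS i) <> - v i.

Definition polygon_curve (R : realType) (n : nat) (v : 'I_n -> 'rV[R]_3) :
  set 'rV[R]_3 := \bigcup_(i in [set: 'I_n]) edge v i.

Definition nb_edges_at (R : realType) (n : nat) (v : 'I_n -> 'rV[R]_3)
  (x : 'rV[R]_3) : nat := #|[pred i : 'I_n | `[< edge v i x >]]|.

(* Edges are counted by index, so for 3 <= n this excludes repeated vertices,
   in particular degenerate edges. *)
Definition simple_polygon (R : realType) (n : nat) (v : 'I_n -> 'rV[R]_3) :
  Prop :=
  [/\ polygon v,
      forall k, nb_edges_at v (v k) = 2%N &
      forall x, (forall k, x <> v k) -> (nb_edges_at v x <= 1)%N].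

Definition perim (R : realType) (n : nat) (v : 'I_n -> 'rV[R]_3) : R :=
  \sum_(i < n) sdist (v i) (v (ordS i)).

(* The last condition says that a, b, c do not lie on a common great circle. *)
Definition triangle (R : realType) (a b c : 'rV[R]_3) : Prop :=
  [/\ S2 a, S2 b, S2 c &
      forall u, dot u a = 0 -> dot u b = 0 -> dot u c = 0 -> u = 0].

Definition inscribed (R : realType) (a b c : 'rV[R]_3) (C : set 'rV[R]_3) :
  Prop := [/\ sboundary C a, sboundary C b & sboundary C c].

(* Main.v *)
Require Import Defs.
From HB Require Import structures.
From mathcomp Require Import all_boot all_order all_algebra.
From mathcomp Require Import all_classical all_reals all_analysis.
From mathcomp Require Import ring lra.
Import Order.TTheory GRing.Theory Num.Theory.
Import numFieldNormedType.Exports.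
Local Open Scope classical_set_scope.
Local Open Scope ring_scope.
Set Implicit Arguments.
Unset Strict Implicit.
Unset Printing Implicit Defensive.

(** The disk is a cap about [o]; let [C] and [sn] be the cosine and the sine of
    its radius. For [0 <= k <= 1 / 2] the isosceles triangles inscribed in it
    form a family, with base and legs of cosines [cosbase sn k] and
    [cosleg sn k], going from a base that is a diameter to the equilateral
    triangle. The longest edge [A B] of the polygon is generally taken as base,
    which fixes [k]. As every edge is at most the base, the theorem follows once
    two distinct edges are found whose lengths add up to at most two legs.

    For a triangle these are the two other edges ([legs_le]). In general let the
    line be the great circle through [A] and [B]; it cuts a chord from the cap,
    whose perpendicular bisector separates the cap into an upper half,
    containing [A], and a lower half, containing [B]. The number of edges is
    odd, so the vertices cannot alternate between the halves, and some edge does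
    not go from one open half to the other ([unsigned_edge]). Such an edge is at
    most a leg. If it stays on one side of the line it lies in a quarter of
    the cap, whose diameter is at most a leg ([quarter_dist]). If it crosses the
    line, then, the polygon being simple, it passes beyond [A] or [B]
    ([edge_clears]); were it longer than a leg, it would cross too low for that
    ([around_le_leg]).

    So two edges of this kind suffice. If there is only one, its two neighbours
    go from one half to the other, and one of them is short enough to
    compensate: their sum is compared with two sides of a triangle in the cap
    whose third side is at least the base ([legs_le]), or with a path through
    the midpoint of the chord, by exchanging the diagonals of a quadrilateral
    ([descending_edge], [lone_edge]).

    These estimates have spherical corrections that are small relative to
    [1 - 2 * k], so they are made for [k <= 49 / 100]. When the longest edge is
    closer than that to the side of the equilateral triangle and there are at
    least five edges, the triangle whose base is a diameter gives the bound,
    with room to spare ([long_base]). *)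

(** * Inner products and spherical distance *)

Section Dot.
Variable R : realType.
Implicit Types (x y z u w : 'rV[R]_3) (s t a b : R).

Lemma dotE x y :
  dot x y = x 0 0 * y 0 0 + x 0 1 * y 0 1 + x 0 2%:R * y 0 2%:R.
Proof.
rewrite /dot !big_ord_recl big_ord0 addr0 addrA.
by congr (_ + _ * _ + _ * _); congr (_ _ _); apply: val_inj.
Qed.

Lemma dotC x y : dot x y = dot y x.
Proof. by apply: eq_bigr => i _; rewrite mulrC. Qed.

Lemma dotDr x y z : dot x (y + z) = dot x y + dot x z.
Proof. by rewrite -big_split; apply: eq_bigr => i _; rewrite mxE mulrDr. Qed.

Lemma dotZr x s y : dot x (s *: y) = s * dot x y.
Proof. by rewrite mulr_sumr; apply: eq_bigr => i _; rewrite mxE mulrCA. Qed.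

Lemma dotDl x y z : dot (x + y) z = dot x z + dot y z.
Proof. by rewrite !(dotC _ z) dotDr. Qed.

Lemma dotZl x s y : dot (s *: y) x = s * dot y x.
Proof. by rewrite !(dotC _ x) dotZr. Qed.

Lemma dotNr x y : dot x (- y) = - dot x y.
Proof. by rewrite -scaleN1r dotZr mulN1r. Qed.

Lemma dotNl x y : dot (- x) y = - dot x y.
Proof. by rewrite dotC dotNr dotC. Qed.

Definition dotL := (dotDl, dotDr, dotZl, dotZr, dotNl, dotNr).

Lemma dot_ge0 x : 0 <= dot x x.
Proof. by apply: sumr_ge0 => i _; rewrite -expr2 sqr_ge0. Qed.

Lemma dot_eq0 x : dot x x = 0 -> x = 0.
Proof.
move=> /eqP; rewrite psumr_eq0; last by move=> i _; rewrite -expr2 sqr_ge0.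
move=> /allP h; apply/rowP => i; rewrite mxE; apply/eqP.
by have /implyP/(_ isT) := h i (mem_index_enum i); rewrite mulf_eq0 orbb.
Qed.

Lemma cauchy_schwarz x y : dot x y ^+ 2 <= dot x x * dot y y.
Proof.
rewrite -subr_ge0 !dotE.
set a := x 0 0; set b := x 0 1; set c := x 0 2%:R.
set d := y 0 0; set e := y 0 1; set f := y 0 2%:R.
rewrite [X in 0 <= X](_ : _ = (a * e - b * d) ^+ 2 + (a * f - c * d) ^+ 2 +
  (b * f - c * e) ^+ 2); last by ring.
by rewrite !addr_ge0 ?sqr_ge0.
Qed.

Lemma sqr_le1P a : (a ^+ 2 <= 1) = (-1 <= a <= 1).
Proof.
by rewrite -ler_norml -real_normK ?num_real // -{1}(expr1n _ 2) ler_pXn2r // nnegrE.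
Qed.

Lemma S2_dot_bounds x y : S2 x -> S2 y -> -1 <= dot x y <= 1.
Proof.
rewrite /S2 /= => hx hy.
by have := cauchy_schwarz x y; rewrite hx hy mulr1 sqr_le1P.
Qed.

Lemma S2_dot_eq1 x y : S2 x -> S2 y -> dot x y = 1 -> x = y.
Proof.
rewrite /S2 /= => hx hy hxy; apply/eqP; rewrite -subr_eq0; apply/eqP/dot_eq0.
by rewrite !dotL hx hy (dotC y) hxy; ring.
Qed.

Lemma le_acos a b : -1 <= a -> a <= b -> b <= 1 -> acos b <= acos a.
Proof.
move=> ha hab hb; rewrite leNgt; apply/negP => h.
have ia : -1 <= a <= 1 by rewrite ha (le_trans hab).
have ib : -1 <= b <= 1 by rewrite hb (le_trans ha).
have ma : acos a \in `[0, pi] by rewrite in_itv /= acos_ge0 ?acos_lepi.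
have mb : acos b \in `[0, pi] by rewrite in_itv /= acos_ge0 ?acos_lepi.
have := ltr_cos ma mb; rewrite h !acosK ?in_itv //=.
by rewrite ltNge hab.
Qed.

Lemma acos_le_inv a b : -1 <= a <= 1 -> -1 <= b <= 1 ->
  acos b <= acos a -> a <= b.
Proof.
move=> ia ib h; rewrite leNgt; apply/negP => hba.
have ma : acos a \in `[0, pi] by rewrite in_itv /= acos_ge0 ?acos_lepi.
have mb : acos b \in `[0, pi] by rewrite in_itv /= acos_ge0 ?acos_lepi.
have := ltr_cos ma mb; rewrite !acosK ?in_itv //= hba.
by rewrite ltNge h.
Qed.

(** Sum-to-product: the mean of the two cosines is [cos s * cos d], with [s] the
    mean and [d] half the difference of the angles, hence, being positive, at most [cos s]. *)
Lemma acos_sum_le a b t : -1 <= a <= 1 -> -1 <= b <= 1 -> 0 < t ->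
  2 * t <= a + b -> acos a + acos b <= 2 * acos t.
Proof.
move=> ia ib t0 hab.
have t1 : t <= 1 by case/andP: ia => _; case/andP: ib => _; lra.
have A0 := acos_ge0 ia; have Api := acos_lepi ia.
have B0 := acos_ge0 ib; have Bpi := acos_lepi ib.
set A := acos a in A0 Api *; set B := acos b in B0 Bpi *.
set s := (A + B) / 2; set d := (A - B) / 2.
have hs : cos s * cos d = (a + b) / 2.
  have aE : a = cos (s + d) by rewrite -[LHS](acosK (x := a)) ?in_itv //= /s /d; congr cos; rewrite -/A; lra.
  have bE : b = cos (s - d) by rewrite -[LHS](acosK (x := b)) ?in_itv //= /s /d; congr cos; rewrite -/B; lra.
  by rewrite aE bE cosD cosB; lra.
have hd : 0 <= cos d by apply: cos_ge0_pihalf; rewrite /d; apply/andP; split; lra.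
have hd1 := cos_le1 d.
have hcs : t <= cos s.
  have [hs0|hs0] := leP 0 (cos s).
    by have := ler_wpM2l hs0 hd1; rewrite hs mulr1; lra.
  by have := ler_wpM2r hd (ltW hs0); rewrite hs mul0r; lra.
have si : s \in `[0, pi] by rewrite in_itv /=; apply/andP; split; rewrite /s; lra.
have h : acos (cos s) <= acos t by apply: le_acos; rewrite ?cos_le1 //; lra.
by move: h; rewrite cosK // /s; lra.
Qed.

Lemma sdistC x y : sdist x y = sdist y x.
Proof. by rewrite /sdist dotC. Qed.

Lemma sdist_ge0 x y : S2 x -> S2 y -> 0 <= sdist x y.
Proof. by move=> hx hy; apply/acos_ge0/S2_dot_bounds. Qed.

(** Cauchy-Schwarz for the components of [x] and [z] orthogonal to [y] compares
    [dot x z] with the cosine of the sum of the two distances. *)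
Lemma sdist_triangle x y z : S2 x -> S2 y -> S2 z ->
  sdist x z <= sdist x y + sdist y z.
Proof.
move=> hx hy hz; have ixy := S2_dot_bounds hx hy.
have iyz := S2_dot_bounds hy hz; have ixz := S2_dot_bounds hx hz.
rewrite /sdist; set a := dot x y in ixy *; set b := dot y z in iyz *.
set k := dot x z in ixz *.
have [hpi|hpi] := ltP pi (acos a + acos b).
  by rewrite (le_trans (acos_lepi ixz)) // ltW.
have m : acos a + acos b \in `[0, pi].
  by rewrite in_itv /= addr_ge0 ?acos_ge0.
rewrite -[leRHS](cosK m); apply: le_acos; [exact: cos_geN1| |by case/andP: ixz].
rewrite cosD !acosK ?in_itv //= !sin_acos //.
have := cauchy_schwarz (x - a *: y) (z - b *: y).
move: hx hy hz; rewrite /S2 /= => hx hy hz.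
rewrite !dotL hx hy hz (dotC z) (dotC y x) -/a -/b -/k => hcs.
have ha : 0 <= 1 - a ^+ 2 by rewrite subr_ge0 sqr_le1P.
have hcs' : (a * b - k) ^+ 2 <= (1 - a ^+ 2) * (1 - b ^+ 2).
  apply: le_trans (le_trans hcs _); rewrite le_eqVlt; apply/orP; left; apply/eqP; ring.
rewrite lerBlDr -lerBlDl -sqrtrM //.
by rewrite (le_trans (ler_norm _)) // -sqrtr_sqr ler_wsqrtr.
Qed.

(** Equality case of the triangle inequality: with [z = s x + t y], the sines of
    the two parts of the arc are [t] and [s] times the sine of the whole. The
    signs of [dot x z] and [dot z y] exclude arcs longer than a half circle. *)
Lemma sdist_split x y z s t : S2 x -> S2 y -> S2 z -> 0 <= s -> 0 <= t ->
  z = s *: x + t *: y -> 0 <= dot x z -> 0 <= dot z y ->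
  sdist x y = sdist x z + sdist z y.
Proof.
move=> hx hy hz s0 t0 zE xz0 zy0; apply/eqP; rewrite eq_le sdist_triangle //=.
have ixz := S2_dot_bounds hx hz; have izy := S2_dot_bounds hz hy.
have ixy := S2_dot_bounds hx hy.
have half a : 0 <= a -> -1 <= a <= 1 -> acos a <= pi / 2.
  by move=> a0 ia; rewrite -acos0; apply: le_acos => //; case/andP: ia.
have m : sdist x z + sdist z y \in `[0, pi].
  rewrite in_itv /= addr_ge0 ?acos_ge0 //=.
  by have := half _ xz0 ixz; have := half _ zy0 izy; rewrite /sdist; lra.
rewrite -[leLHS](cosK m); apply: le_acos; rewrite ?cos_le1 //; first by case/andP: ixy.
rewrite /sdist cosD !acosK ?in_itv //= !sin_acos //.
move: hx hy hz; rewrite /S2 /= => hx hy hz; set k := dot x y in ixy *.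
have xzE : dot x z = s + t * k by rewrite zE !dotL hx -/k mulr1.
have zyE : dot z y = s * k + t by rewrite zE !dotL hy -/k mulr1.
have h1 : s ^+ 2 + t ^+ 2 + 2 * s * t * k = 1.
  by transitivity (dot z z) => //; rewrite zE !dotL hx hy (dotC y) -/k; ring.
have k1 : 0 <= 1 - k ^+ 2 by rewrite subr_ge0 sqr_le1P.
have -> : 1 - dot x z ^+ 2 = (t ^+ 2) * (1 - k ^+ 2) by transitivity (s ^+ 2 + t ^+ 2 + 2 * s * t * k - dot x z ^+ 2); [rewrite h1|rewrite xzE; ring].
have -> : 1 - dot z y ^+ 2 = (s ^+ 2) * (1 - k ^+ 2) by transitivity (s ^+ 2 + t ^+ 2 + 2 * s * t * k - dot z y ^+ 2); [rewrite h1|rewrite zyE; ring].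
rewrite (sqrtrM _ (sqr_ge0 t)) (sqrtrM _ (sqr_ge0 s)) !sqrtr_sqr !ger0_norm //.
rewrite mulrACA -expr2 sqr_sqrtr // xzE zyE.
rewrite -subr_ge0 [X in 0 <= X](_ : _ = k * (s ^+ 2 + t ^+ 2 + 2 * s * t * k - 1)); last by ring.
by rewrite h1 subrr mulr0.
Qed.

End Dot.

(** * Distances in a small spherical cap *)

Section Cap.
Variables (R : realType) (o : 'rV[R]_3) (C sn : R).
Hypotheses (So : S2 o) (C0 : 0 < C) (sn0 : 0 < sn).
Hypotheses (Csn : C ^+ 2 + sn ^+ 2 = 1) (sn_small : sn ^+ 2 <= 1 / 100).
Implicit Types (x y z p q m b : 'rV[R]_3) (s t r k : R).

Lemma sqr_le_bounds (a b : R) : 0 <= b -> a ^+ 2 <= b ^+ 2 -> - b <= a <= b.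
Proof.
move=> b0 h; rewrite -ler_norml -(ler_pXn2r (n := 2)) ?nnegrE ?normr_ge0 //.
by rewrite real_normK ?num_real.
Qed.

(** The disk about [o] whose radius has cosine [C] and sine [sn]; the
    trigonometric functions of the radius enter only through [Csn]. *)
Definition cap : set 'rV[R]_3 := [set x | S2 x /\ C <= dot o x].

Lemma cap_S2 x : cap x -> S2 x. Proof. by case. Qed.

(** Cauchy-Schwarz for the components orthogonal to [o]. *)
Lemma dot_tangent_bound x y :
  (dot x y - dot o x * dot o y) ^+ 2 <=
  (dot x x - dot o x ^+ 2) * (dot y y - dot o y ^+ 2).
Proof.
have := cauchy_schwarz (x - dot o x *: o) (y - dot o y *: o).
have So' : dot o o = 1 := So.
rewrite !dotL So' (dotC x o) (dotC y o) => h.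
apply: le_trans (le_trans h _); rewrite le_eqVlt; apply/orP; left; apply/eqP; ring.
Qed.

Lemma cap_tangent x : cap x -> 1 - dot o x ^+ 2 <= sn ^+ 2.
Proof.
case=> hx h; have : C ^+ 2 <= dot o x ^+ 2 by rewrite ler_pXn2r ?nnegrE // ltW // (lt_le_trans C0).
by move: Csn; lra.
Qed.

Lemma C_bounds : 99 / 100 <= C <= 1.
Proof.
have sq0 := sqr_ge0 sn.
by apply/andP; split; rewrite leNgt; apply/negP => h; move: Csn sn_small C0; nra.
Qed.

Lemma cap_dot_diameter x y : cap x -> cap y -> 1 - 2 * sn ^+ 2 <= dot x y.
Proof.
move=> cx cy; have := dot_tangent_bound x y.
have hx := cap_tangent cx; have hy := cap_tangent cy.
have tx : 0 <= 1 - dot o x ^+ 2.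
  by rewrite subr_ge0 sqr_le1P (S2_dot_bounds So (cap_S2 cx)).
have ty : 0 <= 1 - dot o y ^+ 2.
  by rewrite subr_ge0 sqr_le1P (S2_dot_bounds So (cap_S2 cy)).
case: cx => Sx Cx; case: cy => Sy Cy.
move: Sx Sy; rewrite /S2 /= => -> -> h.
have /(sqr_le_bounds (sqr_ge0 sn))/andP[h1 _] :
    (dot x y - dot o x * dot o y) ^+ 2 <= (sn ^+ 2) ^+ 2.
  by rewrite (le_trans h) // expr2 ler_pM.
have : C * C <= dot o x * dot o y by apply: ler_pM => //; exact: ltW.
by rewrite -expr2; move: Csn; lra.
Qed.

Lemma cap_dot_gt0 x y : cap x -> cap y -> 0 < dot x y.
Proof. by move=> cx cy; have := cap_dot_diameter cx cy; move: sn_small; lra. Qed.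

Lemma cap_dot_ge0 x y : cap x -> cap y -> 0 <= dot x y.
Proof. by move=> cx cy; rewrite ltW // cap_dot_gt0. Qed.

(** Cosines of the base and of the two legs of the isosceles triangle with
    vertices on the boundary circle whose apex is at [sn] and whose base is at
    [- k * sn] along one direction orthogonal to [o]. The triangle is equilateral
    for [k = 1 / 2], and its base is a diameter for [k = 0]. *)
Definition cosbase k : R := 1 - 2 * sn ^+ 2 * (1 - k ^+ 2).
Definition cosleg k : R := 1 - sn ^+ 2 * (1 + k).

Lemma cosbase_bounds k : 0 <= k <= 1 -> -1 <= cosbase k <= 1.
Proof.
move=> /andP[k0 k1]; rewrite /cosbase.
have : 0 <= k ^+ 2 <= 1 by rewrite sqr_ge0 expr_le1.
have := sqr_ge0 sn; move: sn_small; move: (sn ^+ 2) (k ^+ 2) => S K h1 h2 h3.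
by apply/andP; split; nra.
Qed.

Lemma cosleg_bounds k : 0 <= k <= 1 -> 1 / 2 <= cosleg k <= 1.
Proof.
move=> /andP[k0 k1]; rewrite /cosleg.
have := sqr_ge0 sn; move: sn_small; move: (sn ^+ 2) => S h1 h2.
by apply/andP; split; nra.
Qed.

(** By linearity only [p + q] matters. Along [o] it contributes at least
    [2 * C ^+ 2]; orthogonally to [o], [x] has norm at most [sn], and [p + q] has
    norm at most [2 * k * sn] because [p] and [q] are far apart. *)
Lemma dot_legs p q x k : cap p -> cap q -> cap x -> 0 <= k ->
  dot p q <= cosbase k -> 2 * cosleg k <= dot x p + dot x q.
Proof.
move=> cp cq cx k0 hpq.
have := dot_tangent_bound x (p + q).
have tx := cap_tangent cx.
have tx0 : 0 <= 1 - dot o x ^+ 2.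
  by rewrite subr_ge0 sqr_le1P (S2_dot_bounds So (cap_S2 cx)).
case: cx => Sx Cx; case: cp => Sp Cp; case: cq => Sq Cq.
move: Sx Sp Sq; rewrite /S2 /= => Sx Sp Sq.
rewrite !dotL Sx Sp Sq (dotC q p) => h.
set P0 := dot o p + dot o q in h.
have P0C : 2 * C <= P0 by rewrite /P0; lra.
have P0sq : 4 * C ^+ 2 <= P0 ^+ 2.
  by have := ler_pM _ _ P0C P0C; rewrite !mulr_ge0 ?(ltW C0) // => /(_ isT isT); rewrite -!expr2; lra.
have h2 : (dot x p + dot x q - dot o x * P0) ^+ 2 <= (2 * sn ^+ 2 * k) ^+ 2.
  apply: le_trans h _.
  apply: le_trans (_ : sn ^+ 2 * (4 * sn ^+ 2 * k ^+ 2) <= _); last first.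
    by rewrite le_eqVlt; apply/orP; left; apply/eqP; ring.
  have e1 : 1 + dot p q + (dot p q + 1) - P0 ^+ 2 <= 4 * sn ^+ 2 * k ^+ 2.
    by move: hpq P0sq Csn; rewrite /cosbase; lra.
  have e2 : 0 <= 4 * sn ^+ 2 * k ^+ 2 by rewrite mulr_ge0 ?sqr_ge0 // mulr_ge0 ?sqr_ge0.
  exact: le_trans (ler_wpM2l tx0 e1) (ler_wpM2r e2 tx).
have /(sqr_le_bounds)/(_ h2)/andP[h3 _] : 0 <= 2 * sn ^+ 2 * k by rewrite mulr_ge0 // mulr_ge0 ?sqr_ge0.
have h4 : C * (2 * C) <= dot o x * P0.
  by move: P0C Cx C0; nra.
by move: h3 h4 Csn; rewrite /cosleg; lra.
Qed.

(** Among the triangles in a cap with one side at least the base, the inscribed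
    isosceles triangle has the two longest other sides, in sum. *)
Lemma legs_le p q x k : cap p -> cap q -> cap x -> 0 <= k <= 1 ->
  acos (cosbase k) <= sdist p q ->
  sdist x p + sdist x q <= 2 * acos (cosleg k).
Proof.
move=> cp cq cx k01 h; have /andP[l0 _] := cosleg_bounds k01.
have /andP[k0 _] := k01.
apply: acos_sum_le; [exact: (S2_dot_bounds cx.1 cp.1)|exact: (S2_dot_bounds cx.1 cq.1)|lra|].
apply: dot_legs => //; apply: acos_le_inv h; last exact: cosbase_bounds.
exact: (S2_dot_bounds cp.1 cq.1).
Qed.

Lemma sdist_le_dot x y t : cap x -> cap y -> -1 <= t -> t <= dot x y ->
  sdist x y <= acos t.
Proof.
move=> cx cy t1 h; apply: le_acos => //.
by have /andP[] := S2_dot_bounds cx.1 cy.1.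
Qed.

Lemma sdist_le x y z w : cap x -> cap y -> cap z -> cap w ->
  dot z w <= dot x y -> sdist x y <= sdist z w.
Proof.
move=> cx cy cz cw h; apply: sdist_le_dot => //.
by have /andP[] := S2_dot_bounds cz.1 cw.1.
Qed.

Lemma sdist_gt0 x y : cap x -> cap y -> x <> y -> 0 < sdist x y.
Proof.
move=> cx cy xy; have /andP[h1 h2] := S2_dot_bounds cx.1 cy.1.
apply: acos_gt0; rewrite h1 lt_neqAle h2 andbT; apply/eqP => e.
by apply: xy; apply: S2_dot_eq1 e; [exact: cx.1|exact: cy.1].
Qed.

(** The filled spherical triangle, as the part of the sphere in a cone. *)
Definition solid_triangle x y z : set 'rV[R]_3 :=
  [set q | S2 q /\ exists s t r, [/\ 0 <= s, 0 <= t, 0 <= r &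
     q = s *: x + t *: y + r *: z]].

(** Take the inner product of [q] with itself: those of unit vectors are at
    most 1. *)
Lemma solid_weight x y z q s t r : cap x -> cap y -> cap z -> S2 q ->
  0 <= s -> 0 <= t -> 0 <= r -> q = s *: x + t *: y + r *: z -> 1 <= s + t + r.
Proof.
move=> cx cy cz Sq s0 t0 r0 qE.
have := S2_dot_bounds Sq cx.1; have := S2_dot_bounds Sq cy.1.
have := S2_dot_bounds Sq cz.1 => /andP[_ h3] /andP[_ h2] /andP[_ h1].
have -> : (1 : R) = s * dot q x + t * dot q y + r * dot q z.
  by rewrite -!dotZr -!dotDr -qE.
by nra.
Qed.

Lemma solid_cap x y z q : cap x -> cap y -> cap z -> solid_triangle x y z q -> cap q.
Proof.
move=> cx cy cz [Sq [s [t [r [s0 t0 r0 qE]]]]]; split=> //.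
have h := solid_weight cx cy cz Sq s0 t0 r0 qE.
case: cx => _ hx; case: cy => _ hy; case: cz => _ hz.
by rewrite qE !dotL; move: C0; nra.
Qed.

(** Distance to a fixed point of a cap is quasi-convex: its cosine is a linear
    form that is nonnegative at the vertices, and the weights add up to at
    least 1. *)
Lemma solid_far a x y z q : cap a -> cap x -> cap y -> cap z ->
  solid_triangle x y z q ->
  [\/ sdist a q <= sdist a x, sdist a q <= sdist a y | sdist a q <= sdist a z].
Proof.
move=> ca cx cy cz hq; have cq := solid_cap cx cy cz hq.
case: hq => Sq [s [t [r [s0 t0 r0 qE]]]].
have h := solid_weight cx cy cz Sq s0 t0 r0 qE.
have key (m : R) : 0 <= m -> m <= dot a x -> m <= dot a y -> m <= dot a z -> m <= dot a q.
  by move=> m0 mx my mz; rewrite qE !dotL; nra.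
have ax := cap_dot_ge0 ca cx; have ay := cap_dot_ge0 ca cy.
have az := cap_dot_ge0 ca cz.
have [xy|xy] := leP (dot a x) (dot a y); have [xz|xz] := leP (dot a x) (dot a z);
  have [yz|yz] := leP (dot a y) (dot a z).
- by apply: Or31; apply: sdist_le => //; apply: key => //; lra.
- by apply: Or31; apply: sdist_le => //; apply: key => //; lra.
- by apply: Or33; apply: sdist_le => //; apply: key => //; lra.
- by apply: Or33; apply: sdist_le => //; apply: key => //; lra.
- by apply: Or32; apply: sdist_le => //; apply: key => //; lra.
- by apply: Or33; apply: sdist_le => //; apply: key => //; lra.
- by apply: Or32; apply: sdist_le => //; apply: key => //; lra.
- by apply: Or33; apply: sdist_le => //; apply: key => //; lra.
Qed.

Lemma segment_solid x y q z : segment x y q -> solid_triangle x y z q.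
Proof.
case=> Sq [s [t [s0 t0 qE]]]; split=> //; exists s, t, 0; split=> //.
by rewrite scale0r addr0.
Qed.

Lemma segment_cap x y q : cap x -> cap y -> segment x y q -> cap q.
Proof. by move=> cx cy /(segment_solid x); apply: solid_cap. Qed.

Lemma segment_far a x y q : cap a -> cap x -> cap y -> segment x y q ->
  sdist a q <= sdist a x \/ sdist a q <= sdist a y.
Proof.
move=> ca cx cy /(segment_solid x) hq.
by case: (solid_far ca cx cy cx hq); [left|right|left].
Qed.

Lemma segment_sdist x y q : cap x -> cap y -> segment x y q ->
  sdist x y = sdist x q + sdist q y.
Proof.
move=> cx cy h; have cq := segment_cap cx cy h.
case: h => Sq [s [t [s0 t0 qE]]].
by apply: (sdist_split cx.1 cy.1 Sq s0 t0 qE); apply: cap_dot_ge0.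
Qed.

Lemma segmentC x y q : segment x y q -> segment y x q.
Proof.
by case=> Sq [s [t [s0 t0 qE]]]; split=> //; exists t, s; rewrite qE addrC.
Qed.

Lemma cone_segment x y s t : cap x -> cap y -> 0 <= s -> 0 <= t -> 0 < s + t ->
  exists2 k, 0 < k & segment x y (k *: (s *: x + t *: y)).
Proof.
move=> cx cy s0 t0 st; set u := _ + _.
have u0 : 0 < dot u u.
  rewrite lt_neqAle dot_ge0 andbT; apply/eqP => /esym/dot_eq0 e.
  have : dot o u = 0 by rewrite e -(scale0r u) dotZr mul0r.
  rewrite /u !dotL; case: cx => _ hx; case: cy => _ hy.
  by move: C0; nra.
have kE : (Num.sqrt (dot u u))^-1 ^+ 2 * dot u u = 1.
  by rewrite exprVn sqr_sqrtr ?(ltW u0) // mulVf // gt_eqF.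
set k := (Num.sqrt (dot u u))^-1 in kE *.
have k0 : 0 < k by rewrite invr_gt0 sqrtr_gt0.
exists k => //; split; first by rewrite /S2 /= dotZl dotZr mulrA -expr2.
exists (k * s), (k * t); rewrite !mulr_ge0 ?(ltW k0) //; split => //.
by rewrite /u scalerDr !scalerA.
Qed.

(** A path inside a triangle is shorter than the two outer sides: prolong the arc
    from [x] to [q] up to the side [m z]. *)
Lemma nested_path x m z q : cap x -> cap m -> cap z -> solid_triangle x m z q ->
  sdist x q + sdist q z <= sdist x m + sdist m z.
Proof.
move=> cx cm cz hq; have cq := solid_cap cx cm cz hq.
case: hq => Sq [s [t [r [s0 t0 r0 qE]]]].
have [e|tr] := eqVneq (t + r) 0.
  have t1 : t = 0 by lra.
  have r1 : r = 0 by lra.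
  have qx : q = s *: x by rewrite qE t1 r1 !scale0r !addr0.
  have hs : s = 1.
    have := Sq; rewrite /S2 /= qx !dotL; have := cx.1; rewrite /S2 /= => ->.
    by rewrite mulr1 -expr2 => /eqP; rewrite sqrf_eq1 => /orP[/eqP //|/eqP e1]; lra.
  have -> : q = x by rewrite qx hs scale1r.
  rewrite {1}/sdist; have := cx.1; rewrite /S2 /= => ->; rewrite acos1 add0r.
  by apply: sdist_triangle; [exact: cx.1|exact: cm.1|exact: cz.1].
have tr0 : 0 < t + r by rewrite lt_neqAle eq_sym tr addr_ge0.
have [k k0 hw] := cone_segment cm cz t0 r0 tr0.
set w := _ *: _ in hw; have cw := segment_cap cm cz hw.
have hq : segment x w q.
  split=> //; exists s, k^-1; split=> //; first by rewrite invr_ge0 ltW.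
  by rewrite /w scalerA mulVf ?gt_eqF // scale1r qE addrA.
have := segment_sdist cx cw hq; have := segment_sdist cm cz hw.
have := sdist_triangle cq.1 cw.1 cz.1.
have := sdist_triangle cx.1 cm.1 cw.1.
by lra.
Qed.

(** The diagonals of a quadrilateral are together longer than two opposite
    sides, by the triangle inequality through their intersection. *)
Lemma crossing_exchange p p' q q' z : cap p -> cap p' -> cap q -> cap q' ->
  segment p q' z -> segment q p' z ->
  sdist p p' + sdist q q' <= sdist p q' + sdist q p'.
Proof.
move=> cp cp' cq cq' h1 h2; have cz := segment_cap cp cq' h1.
have := segment_sdist cp cq' h1; have := segment_sdist cq cp' h2.
have := sdist_triangle cp.1 cz.1 cp'.1.
have := sdist_triangle cq.1 cz.1 cq'.1.
by lra.
Qed.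

End Cap.

(** * Coordinate inequalities in a cap *)

(** In this part a point of the cap has coordinates [x0], along the centre, and
    [x1], [x2], orthogonal to it. A great circle crossing the cap is written
    [x1 + c * x0 = 0]; the bound on [c * C] says that it cuts off a chord at
    least as long as the base of parameter [kap]. The plane [x2 = 0] is its
    perpendicular bisector: with [x1 + c * x0 = 0] it divides the cap into four
    quarters. *)

Section CapInequalities.
Variables (R : realType) (C sn kap : R).
Implicit Types (c s p q x y z : R).
Hypotheses (C0 : 0 < C) (sn0 : 0 < sn).
Hypotheses (Csn : C ^+ 2 + sn ^+ 2 = 1) (sn_small : sn ^+ 2 <= 1 / 100).
Hypotheses (kap0 : 0 <= kap) (kap1 : kap <= 49 / 100).

Let Cb : 99 / 100 <= C <= 1 := C_bounds C0 Csn sn_small.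

Local Ltac slim := clear - C0 sn0 Csn sn_small kap0 kap1 Cb.

Lemma offset_bound c : - (kap * sn) <= c * C <= kap * sn ->
  - (100 / 99 * kap * sn) <= c <= 100 / 99 * kap * sn.
Proof.
move=> /andP[h1 h2]; case/andP: Cb => hC _.
have ks : 0 <= kap * sn by rewrite mulr_ge0 // ltW.
by apply/andP; split; rewrite leNgt; apply/negP => h; nra.
Qed.

Lemma small_coordinate (x0 x1 x2 : R) : C <= x0 ->
  x0 ^+ 2 + x1 ^+ 2 + x2 ^+ 2 = 1 -> - sn <= x1 <= sn.
Proof.
move=> hx e; apply: sqr_le_bounds; first exact: ltW.
have : C ^+ 2 <= x0 ^+ 2 by rewrite ler_pXn2r ?nnegrE // ltW // (lt_le_trans C0).
by have := sqr_ge0 x2; move: Csn; lra.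
Qed.

Lemma offset_product c y1 : - (kap * sn) <= c * C <= kap * sn ->
  - sn <= y1 <= sn -> c * y1 <= 100 / 99 * (kap * sn ^+ 2).
Proof.
move=> /offset_bound/andP[h1 h2] /andP[h3 h4].
have : 0 <= kap * sn by rewrite mulr_ge0 // ltW.
set d := 100 / 99 * kap * sn in h1 h2.
have -> : 100 / 99 * (kap * sn ^+ 2) = d * sn by rewrite /d; ring.
by nra.
Qed.

(** Two points of one quarter are at most a leg apart. Only a product [x1 * y1]
    of opposite signs can make their inner product small; the negative factor
    is then bounded by the offset [c], the other one by [sn]. *)
Lemma quarter_dot c x0 x1 x2 y0 y1 y2 :
  - (kap * sn) <= c * C <= kap * sn ->
  C <= x0 -> C <= y0 ->
  x0 ^+ 2 + x1 ^+ 2 + x2 ^+ 2 = 1 -> y0 ^+ 2 + y1 ^+ 2 + y2 ^+ 2 = 1 ->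
  0 <= x1 + c * x0 -> 0 <= y1 + c * y0 -> 0 <= x2 * y2 ->
  C ^+ 2 - sn ^+ 2 * kap <= x0 * y0 + x1 * y1 + x2 * y2.
Proof.
move=> hc hx hy ex ey lx ly h2.
suff : C ^+ 2 - sn ^+ 2 * kap <= x0 * y0 + x1 * y1 by lra.
have bx := small_coordinate hx ex; have by' := small_coordinate hy ey.
have px := offset_product hc bx; have py := offset_product hc by'.
have CC : C ^+ 2 <= x0 * y0 by rewrite expr2; apply: ler_pM => //; exact: ltW.
have sk : 0 <= sn ^+ 2 * kap by rewrite mulr_ge0 // sqr_ge0.
have [h|h] := leP 0 (x1 * y1); first by lra.
have aux u v w : - sn <= w <= sn -> C <= u -> C <= v ->
    c * w <= 100 / 99 * (kap * sn ^+ 2) -> 0 <= w ->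
    C ^+ 2 - sn ^+ 2 * kap <= u * (v - c * w).
  move=> /andP[w1 w2] hu hv hw w0.
  have h1 : C - c * w <= v - c * w by lra.
  have h3 : 0 <= C - c * w.
    by move: Cb sn_small kap1 hw sk => /andP[]; nra.
  have h4 : C * (C - c * w) <= u * (v - c * w) by apply: ler_pM => //; exact: ltW.
  have h5 : c * C * w <= kap * sn * sn.
    case/andP: hc => _ hc; have h6 : c * C * w <= kap * sn * w by rewrite ler_wpM2r.
    by apply: le_trans h6 _; rewrite ler_wpM2l // mulr_ge0 // ltW.
  by move: h4 h5; rewrite mulrBr !expr2; lra.
have [x10|x10] := leP 0 x1.
  have := aux y0 x0 x1 bx hy hx px x10; nra.
have y10 : 0 <= y1 by nra.
by have := aux x0 y0 y1 by' hx hy py y10; nra.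
Qed.

(** A point [y] of the upper half is nearer to every upper point
    [(z0, - c z0, z2)] of the line than to the lower end [(C, - c C, - s2)] of
    the chord. *)
Lemma above_base_dot c s2 y0 y1 y2 z0 z2 :
  - (kap * sn) <= c * C <= kap * sn -> 0 <= s2 ->
  C <= y0 -> C <= z0 -> y0 ^+ 2 + y1 ^+ 2 + y2 ^+ 2 = 1 -> 0 <= y2 -> 0 <= z2 ->
  y0 * C - y1 * (c * C) - y2 * s2 <= y0 * z0 - y1 * (c * z0) + y2 * z2.
Proof.
move=> hc s20 hy hz ey y20 z20.
have := offset_product hc (small_coordinate hy ey) => h.
have h1 : 0 <= y0 - c * y1 by move: Cb sn_small kap1 h hy => /andP[]; nra.
by nra.
Qed.

(** Direct estimate for an edge [p y] inside the quarter to the right of the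
    line and above the bisector, and the other edge [p q] at its lower
    endpoint, when [y] is not to the left of [p], or [p] is near the plane
    [x1 = 0] or to the left of it. Let [r] be the norm of the component of [p]
    orthogonal to the centre: the inner product with [q] loses at most [r * sn],
    the one with [y] gains [r ^+ 2] up to the allowed error, and
    [r * (sn - r)] is compensated by the excess of [p0] over [C]. *)
Lemma lower_vertex_near c p0 p1 p2 q0 q1 q2 y0 y1 y2 :
  - (kap * sn) <= c * C <= kap * sn ->
  C <= p0 -> C <= q0 -> C <= y0 ->
  p0 ^+ 2 + p1 ^+ 2 + p2 ^+ 2 = 1 -> q0 ^+ 2 + q1 ^+ 2 + q2 ^+ 2 = 1 ->
  y0 ^+ 2 + y1 ^+ 2 + y2 ^+ 2 = 1 ->
  0 <= p1 + c * p0 -> 0 <= y1 + c * y0 -> 0 <= p2 -> p2 <= y2 ->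
  [\/ p1 < 0, p1 <= y1 | p1 ^+ 2 <= kap * sn ^+ 2] ->
  2 * (C ^+ 2 - sn ^+ 2 * kap) <=
  (p0 * y0 + p1 * y1 + p2 * y2) + (p0 * q0 + p1 * q1 + p2 * q2).
Proof.
move=> hc hp hq hy ep eq ey lp ly p20 py hcase.
have /andP[C1 C2] := Cb; have /andP[c1 c2] := offset_bound hc.
have p0le : p0 <= 1 by move: (sqr_ge0 p1) (sqr_ge0 p2); nra.
have y0le : y0 <= 1 by move: (sqr_ge0 y1) (sqr_ge0 y2); nra.
have ks : 0 <= kap * sn by rewrite mulr_ge0 // ltW.
set d := 100 / 99 * kap * sn in c1 c2.
have d0 : 0 <= d by rewrite /d -mulrA; lra.
have ds : d <= 1 / 2 * sn by rewrite /d; move: sn0 kap1; nra.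
have k2 : 0 <= kap * sn ^+ 2 by rewrite mulr_ge0 ?sqr_ge0.
have dd : d * (3 / 2 * sn) <= 2 * (kap * sn ^+ 2).
  have -> : d * (3 / 2 * sn) = 100 / 66 * (kap * sn ^+ 2) by rewrite /d; field.
  by lra.
have p1d : - d <= p1 by move: lp p0le c1 c2 d0 hp C0; slim; nra.
have y1d : - d <= y1 by move: ly y0le c1 c2 d0 hy C0; slim; nra.
have /andP[_ y1s] := small_coordinate hy ey.
have step_b : - (2 * (kap * sn ^+ 2)) <= p1 * (y1 - p1).
  have [p10|p10] := ltP p1 0.
    by move: p10 p1d y1d y1s ds dd d0 k2; slim; nra.
  have [p1y|p1y] := leP p1 y1.
    by have := mulr_ge0 p10 (_ : 0 <= y1 - p1); rewrite subr_ge0 => /(_ p1y); move: k2; slim; lra.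
  case: hcase => [|h|h]; [by rewrite ltNge p10|by rewrite leNgt p1y in h|].
  have : p1 <= 7 / 10 * sn.
    rewrite leNgt; apply/negP => h'; have : (7 / 10 * sn) ^+ 2 < p1 ^+ 2.
      by rewrite ltr_pXn2r ?nnegrE // mulr_ge0 // ltW.
    by move: (sqr_ge0 sn) kap1; nra.
  move=> h'; have : p1 * d <= 7 / 10 * sn * d by rewrite ler_wpM2r.
  by move: dd; nra.
have [r r0 rE] : exists2 r, 0 <= r & r ^+ 2 = p1 ^+ 2 + p2 ^+ 2.
  exists (Num.sqrt (p1 ^+ 2 + p2 ^+ 2)); first exact: sqrtr_ge0.
  by rewrite sqr_sqrtr // addr_ge0 ?sqr_ge0.
have rsn : r <= sn.
  rewrite -(ler_pXn2r (n := 2)) ?nnegrE ?(ltW sn0) // rE.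
  have : C ^+ 2 <= p0 ^+ 2 by rewrite ler_pXn2r ?nnegrE // ltW // (lt_le_trans C0).
  by move: Csn; lra.
have step_a : - (r * sn) <= p1 * q1 + p2 * q2.
  have : (p1 * q1 + p2 * q2) ^+ 2 <= (r * sn) ^+ 2.
    rewrite exprMn rE; have h : q1 ^+ 2 + q2 ^+ 2 <= sn ^+ 2.
      have : C ^+ 2 <= q0 ^+ 2 by rewrite ler_pXn2r ?nnegrE // ltW // (lt_le_trans C0).
      by move: Csn; lra.
    have h' : 0 <= p1 ^+ 2 + p2 ^+ 2 by rewrite addr_ge0 ?sqr_ge0.
    apply: le_trans (ler_wpM2l h' h); rewrite -subr_ge0.
    by rewrite [X in 0 <= X](_ : _ = (p1 * q2 - p2 * q1) ^+ 2) ?sqr_ge0 //; ring.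
  by move=> /(sqr_le_bounds (mulr_ge0 r0 (ltW sn0)))/andP[].
have step_c : r * (sn - r) <= 2 * C * (p0 - C).
  have e : (p0 - C) * (p0 + C) = (sn - r) * (sn + r).
    have -> : (p0 - C) * (p0 + C) = p0 ^+ 2 - C ^+ 2 by ring.
    have -> : (sn - r) * (sn + r) = sn ^+ 2 - r ^+ 2 by ring.
    by move: Csn ep; rewrite rE; lra.
  have h1 : (sn - r) * (sn + r) <= (p0 - C) * 2 by rewrite -e ler_wpM2l //; move: p0le C2 hp; slim; lra.
  have h2 : (sn - r) * (2 * r) <= (sn - r) * (sn + r).
    by rewrite ler_wpM2l //; move: rsn; slim; lra.
  have h3 : 0 <= p0 - C by rewrite subr_ge0.
  have h4 : (p0 - C) * (99 / 100) <= (p0 - C) * C by rewrite ler_wpM2l.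
  have h5 : 0 <= (sn - r) * r by rewrite mulr_ge0 // subr_ge0.
  by move: h1 h2 h3 h4 h5; slim; lra.
have e1 : p0 * C <= p0 * y0 by rewrite ler_wpM2l // (le_trans (ltW C0)).
have e2 : p0 * C <= p0 * q0 by rewrite ler_wpM2l // (le_trans (ltW C0)).
have e3 : p2 ^+ 2 <= p2 * y2 by rewrite expr2 ler_wpM2l.
move: step_a step_b step_c e1 e2 e3 rE; rewrite !mulrBr !expr2; move: ep Csn; rewrite !expr2; slim; lra.
Qed.

End CapInequalities.

Section CapInequalities2.
Variables (R : realType) (C sn kap : R).
Implicit Types (c s p q x y z : R).
Hypotheses (C0 : 0 < C) (sn0 : 0 < sn).
Hypotheses (Csn : C ^+ 2 + sn ^+ 2 = 1) (sn_small : sn ^+ 2 <= 1 / 100).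
Hypotheses (kap0 : 0 <= kap) (kap1 : kap <= 49 / 100).

Local Ltac slim := clear - C0 sn0 Csn sn_small kap0 kap1.

Lemma le_of_sqr (a b : R) : 0 <= b -> a ^+ 2 <= b ^+ 2 -> a <= b.
Proof. by move=> b0 /(sqr_le_bounds b0)/andP[]. Qed.

(** Inside a small cap the coordinate along the centre varies much less than the
    coordinates orthogonal to it, here from the upper end
    [(C, - c1, s2)] of the chord to [y]. *)
Lemma corner_near (c1 s2 y0 y1 y2 : R) : C <= y0 -> 0 <= s2 ->
  y0 ^+ 2 + y1 ^+ 2 + y2 ^+ 2 = 1 -> s2 ^+ 2 = sn ^+ 2 - c1 ^+ 2 ->
  (y0 - C) ^+ 2 <= 1 / 10 * ((y1 + c1) ^+ 2 + (y2 - s2) ^+ 2).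
Proof.
move=> hy s20 ey es.
have /andP[C1 C2] := C_bounds C0 Csn sn_small.
have CC : C ^+ 2 <= y0 ^+ 2 by rewrite ler_pXn2r ?nnegrE // ltW // (lt_le_trans C0).
have e : (y0 - C) * (y0 + C) = (y1 + c1) * (c1 - y1) + (s2 - y2) * (s2 + y2).
  have -> : (y0 - C) * (y0 + C) = y0 ^+ 2 - C ^+ 2 by ring.
  have -> : (y1 + c1) * (c1 - y1) + (s2 - y2) * (s2 + y2) =
            c1 ^+ 2 + s2 ^+ 2 - (y1 ^+ 2 + y2 ^+ 2) by ring.
  by move: Csn ey es; slim; lra.
set u := y1 + c1 in e *; set v := y2 - s2.
set a := c1 - y1 in e; set b := s2 + y2 in e.
have hab : a ^+ 2 + b ^+ 2 <= 4 * sn ^+ 2.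
  apply: le_trans (_ : 2 * (c1 ^+ 2 + s2 ^+ 2) + 2 * (y1 ^+ 2 + y2 ^+ 2) <= _).
    rewrite -subr_ge0 [X in 0 <= X](_ : _ = (c1 + y1) ^+ 2 + (s2 - y2) ^+ 2); last by rewrite /a /b; ring.
    by rewrite addr_ge0 ?sqr_ge0.
  by move: Csn ey es CC; slim; lra.
have h1 : ((y0 - C) * (y0 + C)) ^+ 2 <= (u ^+ 2 + v ^+ 2) * (4 * sn ^+ 2).
  apply: le_trans (_ : (u ^+ 2 + v ^+ 2) * (a ^+ 2 + b ^+ 2) <= _); last first.
    by apply: ler_wpM2l hab; rewrite addr_ge0 ?sqr_ge0.
  rewrite e -subr_ge0 [X in 0 <= X](_ : _ = (u * b + v * a) ^+ 2) ?sqr_ge0 //.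
  by rewrite /v; ring.
have h2 : (y0 - C) ^+ 2 * 3 <= ((y0 - C) * (y0 + C)) ^+ 2.
  by rewrite exprMn ler_wpM2l ?sqr_ge0 //; move: C1 hy; slim; nra.
have : 0 <= u ^+ 2 + v ^+ 2 by rewrite addr_ge0 ?sqr_ge0.
by move: h1 h2 sn_small; slim; nra.
Qed.

(** In the situation complementary to that of [lower_vertex_near], the upper end
    of the chord is at least as far from [p] as [y] is. The difference of the
    two inner products is linear in the displacement from that end to [y]; if
    [y] is higher than it the terms have a sign, and otherwise [p] is lower than
    it by a definite amount, [gap], because [p1] is not small. *)
Lemma corner_farther c s2 p0 p1 p2 y0 y1 y2 :
  - (kap * sn) <= c * C <= kap * sn ->
  0 <= s2 -> s2 ^+ 2 = sn ^+ 2 - (c * C) ^+ 2 ->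
  C <= p0 -> C <= y0 ->
  p0 ^+ 2 + p1 ^+ 2 + p2 ^+ 2 = 1 -> y0 ^+ 2 + y1 ^+ 2 + y2 ^+ 2 = 1 ->
  0 <= y1 + c * y0 -> 0 <= p2 -> p2 <= y2 ->
  0 < p1 -> y1 < p1 -> kap * sn ^+ 2 < p1 ^+ 2 ->
  p0 * C - p1 * (c * C) + p2 * s2 <= p0 * y0 + p1 * y1 + p2 * y2.
Proof.
move=> hc s20 es hp hy ep ey ly p20 py p10 p1y p1k.
have /andP[C1 C2] := C_bounds C0 Csn sn_small.
have /andP[c1 c2] := offset_bound C0 sn0 Csn sn_small kap0 hc.
have hcp := offset_product C0 sn0 Csn sn_small kap0 hc
  (small_coordinate C0 sn0 Csn hp ep).
have /andP[_ p1s] := small_coordinate C0 sn0 Csn hp ep.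
have /andP[y1s _] := small_coordinate C0 sn0 Csn hy ey.
have Dy : 0 <= y0 - C by rewrite subr_ge0.
have hcp' : c * p1 <= p0 by move: hcp hp C1 sn_small kap1 kap0 (sqr_ge0 sn); slim; nra.
have hu : - (c * (y0 - C)) <= y1 + c * C by move: ly; slim; lra.
rewrite -subr_ge0 [X in 0 <= X](_ : _ =
  p0 * (y0 - C) + p1 * (y1 + c * C) + p2 * (y2 - s2)); last by ring.
have [hy2|hy2] := leP s2 y2.
  have : 0 <= p2 * (y2 - s2) by rewrite mulr_ge0 // subr_ge0.
  have : p1 * - (c * (y0 - C)) <= p1 * (y1 + c * C) by rewrite ler_wpM2l // ltW.
  have : 0 <= (y0 - C) * (p0 - c * p1) by rewrite mulr_ge0 // subr_ge0.
  by slim; lra.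
have hE := corner_near hy s20 ey es.
set u := y1 + c * C in hu hE *.
have h0 : C * (y0 - C) <= p0 * (y0 - C) by rewrite ler_wpM2r.
have EE : 2 * (C * (y0 - C) + y1 * u + y2 * (y2 - s2)) =
    u ^+ 2 + (y2 - s2) ^+ 2 - (y0 - C) ^+ 2.
  have e1 : 2 * (C * (y0 - C) + y1 * u + y2 * (y2 - s2)) -
    (u ^+ 2 + (y2 - s2) ^+ 2 - (y0 - C) ^+ 2) =
    (y0 ^+ 2 + y1 ^+ 2 + y2 ^+ 2) - C ^+ 2 - (c * C) ^+ 2 - s2 ^+ 2.
    by rewrite /u; ring.
  by apply/eqP; rewrite -subr_eq0 e1 ey es; apply/eqP; move: Csn; slim; lra.
have u2 := sqr_ge0 u; have v2 := sqr_ge0 (y2 - s2).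
have hp2 : y2 * (y2 - s2) <= p2 * (y2 - s2) by rewrite ler_wnM2r // subr_le0 ltW.
have [u0|u0] := leP 0 u.
  have : y1 * u <= p1 * u by rewrite ler_wpM2r // ltW.
  by move: h0 hp2 EE hE u2 v2; slim; lra.
have cy : 0 < c by rewrite ltNge; apply/negP => c0; move: c0 u0 hu Dy; slim; nra.
set v := s2 - y2; have v0 : 0 < v by rewrite subr_gt0.
have sn2 := sqr_ge0 sn.
have s2sn : s2 <= sn by apply: le_of_sqr; [exact: ltW|rewrite es; move: (sqr_ge0 (c * C)); slim; lra].
have k2 : 0 <= kap * sn ^+ 2 by rewrite mulr_ge0.
(* 255 / 1000 is half of 1 - 49 / 100, as s2 + p2 is at most 2 sn. *)
have gap : 255 / 1000 * kap * sn <= s2 - p2.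
  have e2 : 51 / 100 * kap * sn ^+ 2 <= s2 ^+ 2 - p2 ^+ 2.
    have : p2 ^+ 2 <= sn ^+ 2 - kap * sn ^+ 2.
      have : C ^+ 2 <= p0 ^+ 2 by rewrite ler_pXn2r ?nnegrE // ltW // (lt_le_trans C0).
      by move: Csn ep p1k; slim; lra.
    have : (c * C) ^+ 2 <= (kap * sn) ^+ 2.
      case/andP: hc => _ hc'; rewrite ler_pXn2r ?nnegrE //; first by rewrite mulr_ge0 // ltW.
      by rewrite mulr_ge0 // ltW.
    rewrite es exprMn.
    have : kap ^+ 2 * sn ^+ 2 <= 49 / 100 * (kap * sn ^+ 2).
      by rewrite expr2 -mulrA ler_wpM2r.
    by slim; lra.
  have e3 : (s2 - p2) * (s2 + p2) = s2 ^+ 2 - p2 ^+ 2 by ring.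
  have d0 : 0 <= s2 - p2 by move: py hy2; slim; lra.
  have e4 : (s2 - p2) * (s2 + p2) <= (s2 - p2) * (2 * sn) by rewrite ler_wpM2l //; move: d0 s2sn; slim; lra.
  rewrite -(ler_pM2r sn0); move: e2 e4; rewrite e3 !expr2; slim; lra.
have hDy : y0 - C <= 102 / 100 * sn * v.
  have e5 : (y0 - C) * (y0 + C) = u * (c * C - y1) + v * (s2 + y2).
    apply/eqP; rewrite -subr_eq0; apply/eqP.
    transitivity (y0 ^+ 2 + y1 ^+ 2 + y2 ^+ 2 - C ^+ 2 - (c * C) ^+ 2 - s2 ^+ 2).
      by rewrite /u /v; ring.
    by rewrite ey es; move: Csn; slim; lra.
  have e6 : u * (c * C - y1) <= 0.
    have : 0 < c * C by rewrite mulr_gt0.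
    by rewrite /u in u0 *; move: u0; slim; nra.
  have e7 : v * (s2 + y2) <= v * (2 * sn).
    by rewrite ler_wpM2l ?(ltW v0) //; move: s2sn hy2; slim; lra.
  have e8 : (y0 - C) * (198 / 100) <= (y0 - C) * (y0 + C).
    by rewrite ler_wpM2l //; move: C1 hy; slim; lra.
  have e9 : 0 <= sn * v by rewrite mulr_ge0 ?(ltW v0) ?(ltW sn0).
  by move: e5 e6 e7 e8 e9; slim; lra.
have hpu : - (3 / 100 * kap * sn * v) <= (p1 - y1) * u.
  have e1 : (2 * sn) * - (c * (y0 - C)) <= (p1 - y1) * - (c * (y0 - C)).
    by rewrite ler_wnM2r ?oppr_le0 ?mulr_ge0 ?(ltW cy) //; move: y1s p1s; slim; lra.
  have e2 : (p1 - y1) * - (c * (y0 - C)) <= (p1 - y1) * u.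
    by rewrite ler_wpM2l // subr_ge0 ltW.
  have e3 : c * (y0 - C) <= (100 / 99 * kap * sn) * (102 / 100 * sn * v).
    by apply: ler_pM => //; exact: ltW.
  have e4 : 0 <= kap * sn * v by apply: mulr_ge0 (ltW v0); apply: mulr_ge0 (ltW sn0).
  have e5 : (2 * sn) * (c * (y0 - C)) <= (2 * sn) * ((100 / 99 * kap * sn) * (102 / 100 * sn * v)).
    by rewrite ler_wpM2l // mulr_ge0 // ltW.
  have e6 : (2 * sn) * ((100 / 99 * kap * sn) * (102 / 100 * sn * v)) =
    204 / 99 * (sn ^+ 2 * (kap * sn * v)) by field.
  have e7 : sn ^+ 2 * (kap * sn * v) <= 1 / 100 * (kap * sn * v) by rewrite ler_wpM2r.
  by move: e1 e2 e5 e6 e7 e4; slim; lra.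
have f1 : 0 <= v * (255 / 1000 * (s2 - p2) - 3 / 100 * kap * sn).
  apply: mulr_ge0; first exact: ltW.
  have : 0 <= kap * sn by rewrite mulr_ge0 // ltW.
  by move: gap; slim; lra.
have f2 : v * (9 / 20 * v + (y2 - p2)) >= v * (9 / 20 * (s2 - p2)).
  by rewrite ler_wpM2l ?(ltW v0) // /v; move: py hy2; slim; lra.
have f3 : 0 <= v * (s2 - p2) by rewrite mulr_ge0 ?(ltW v0) //; move: py hy2; slim; lra.
have e9 : (y2 - s2) ^+ 2 = v ^+ 2 by rewrite /v; ring.
rewrite e9 in hE EE.
have -> : p0 * (y0 - C) + p1 * u + p2 * (y2 - s2) =
  (p0 * (y0 - C) - C * (y0 - C)) + (C * (y0 - C) + y1 * u + y2 * (y2 - s2)) +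
   (p1 - y1) * u + (y2 - p2) * v by rewrite /v; ring.
move: h0 EE hE hpu f1 f2 f3 (sqr_ge0 u); slim; clearbody u v.
lra.
Qed.

End CapInequalities2.

Section CapInequalities3.
Variables (R : realType) (C sn kap : R).
Implicit Types (c s p q x y z : R).
Hypotheses (C0 : 0 < C) (sn0 : 0 < sn).
Hypotheses (Csn : C ^+ 2 + sn ^+ 2 = 1) (sn_small : sn ^+ 2 <= 1 / 100).
Hypotheses (kap0 : 0 <= kap) (kap1 : kap <= 49 / 100).

Local Ltac slim := move: (C0) (sn0) (kap0) (kap1); clear - C0 sn0 Csn sn_small kap0 kap1.

Lemma polar (X Y : R) : 0 < X -> 0 <= Y -> exists r ca sa : R,
  [/\ 0 < r, X = r * ca, Y = r * sa & [/\ 0 < ca, 0 <= sa & ca ^+ 2 + sa ^+ 2 = 1]].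
Proof.
move=> X0 Y0; have h : 0 < X ^+ 2 + Y ^+ 2 by rewrite ltr_pwDl ?exprn_gt0 ?sqr_ge0.
have r0 : 0 < Num.sqrt (X ^+ 2 + Y ^+ 2) by rewrite sqrtr_gt0.
have rE : Num.sqrt (X ^+ 2 + Y ^+ 2) ^+ 2 = X ^+ 2 + Y ^+ 2 by rewrite sqr_sqrtr // ltW.
set r := Num.sqrt _ in r0 rE; exists r, (X / r), (Y / r).
have rn : r != 0 by rewrite gt_eqF.
split=> //; [by field|by field|split].
- by rewrite divr_gt0.
- by rewrite divr_ge0 // ltW.
- by rewrite !expr_div_n -mulrDl -rE divff // expf_neq0.
Qed.

(** Sum-to-product bounds for two angles [a], [b] of the first quadrant whose
    sum has cosine at least [kap]. The number [T] is the tangent of half the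
    angle of cosine [kap]; it is also the slope of a leg of the isosceles
    triangle of parameter [kap], seen from its apex. *)
Lemma half_angle_bounds (T ca sa cb sb : R) : 0 < T -> T ^+ 2 * (1 + kap) = 1 - kap ->
  ca ^+ 2 + sa ^+ 2 = 1 -> cb ^+ 2 + sb ^+ 2 = 1 ->
  0 <= ca -> 0 <= sa -> 0 <= cb -> 0 <= sb -> kap <= ca * cb - sa * sb ->
  [/\ sa * cb + ca * sb <= T * (ca + cb), sa - sb <= T * (ca + cb)
    & kap * sa <= (1 + kap) * T * ca].
Proof.
move=> T0 TE ea eb ca0 sa0 cb0 sb0 hk.
set k := ca * cb - sa * sb in hk; set N := sa * cb + ca * sb.
have k1 : k <= 1.
  have : (ca * cb - sa * sb) ^+ 2 + N ^+ 2 = 1.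
    transitivity ((ca ^+ 2 + sa ^+ 2) * (cb ^+ 2 + sb ^+ 2)); first by rewrite /N; ring.
    by rewrite ea eb mulr1.
  by rewrite -/k; move: (sqr_ge0 N); clearbody k N; slim; nra.
have NE : N ^+ 2 = (1 - k) * (1 + k).
  transitivity ((ca ^+ 2 + sa ^+ 2) * (cb ^+ 2 + sb ^+ 2) - k ^+ 2); first by rewrite /N /k; ring.
  by rewrite ea eb; ring.
have DE : (sa - sb) ^+ 2 <= N ^+ 2.
  rewrite -subr_ge0.
  have -> : N ^+ 2 - (sa - sb) ^+ 2 = 2 * (1 + k) * (sa * sb).
    apply/eqP; rewrite -subr_eq0; apply/eqP.
    transitivity (sa ^+ 2 * (cb ^+ 2 + sb ^+ 2 - 1) + sb ^+ 2 * (ca ^+ 2 + sa ^+ 2 - 1)).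
      by rewrite /N /k; ring.
    by rewrite ea eb; ring.
  apply: mulr_ge0; last exact: mulr_ge0.
  by move: hk kap0; clearbody k; slim; lra.
have SE : (1 + k) ^+ 2 <= (ca + cb) ^+ 2.
  have : (ca + cb) ^+ 2 = 2 + 2 * k - (sa - sb) ^+ 2.
    apply/eqP; rewrite -subr_eq0; apply/eqP.
    transitivity ((ca ^+ 2 + sa ^+ 2 - 1) + (cb ^+ 2 + sb ^+ 2 - 1)); first by rewrite /k; ring.
    by rewrite ea eb; ring.
  by move: DE; rewrite NE; slim; lra.
have T2 : 1 - k <= T ^+ 2 * (1 + k).
  have : T ^+ 2 * (1 + kap) <= T ^+ 2 * (1 + k) by rewrite ler_wpM2l ?sqr_ge0 // lerD2l.
  by move: hk TE; slim; lra.
have Tcc : 0 <= T * (ca + cb) by rewrite mulr_ge0 ?addr_ge0 // ltW.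
have main : N ^+ 2 <= (T * (ca + cb)) ^+ 2.
  rewrite exprMn NE; apply: le_trans (_ : T ^+ 2 * (1 + k) ^+ 2 <= _).
    rewrite expr2 mulrA ler_wpM2r //; move: hk kap0; slim; lra.
  by rewrite ler_wpM2l ?sqr_ge0.
split; [exact: le_of_sqr|by apply: le_of_sqr => //; exact: le_trans main|].
have cale : kap <= ca.
  have cb1 : cb <= 1 by apply: le_of_sqr => //; rewrite expr1n; move: (sqr_ge0 sb) eb; slim; lra.
  have : ca * cb <= ca by rewrite ler_piMr.
  by move: hk (mulr_ge0 sa0 sb0); rewrite /k; slim; lra.
have sale : sa <= (1 + kap) * T.
  apply: le_of_sqr; first by rewrite mulr_ge0 ?addr_ge0 // ltW.
  have -> : ((1 + kap) * T) ^+ 2 = (1 + kap) * (1 - kap) by rewrite -TE; ring.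
  have : kap ^+ 2 <= ca ^+ 2 by rewrite ler_pXn2r ?nnegrE.
  by move: ea; rewrite !expr2; slim; lra.
apply: le_trans (ler_wpM2l kap0 sale) _; rewrite mulrC ler_wpM2l //.
by rewrite mulr_ge0 ?addr_ge0 // ltW.
Qed.

(** If an arc [x y] in the upper half crosses the line [x1 + c x0 = 0] and is
    longer than a leg, then it crosses low: below the leg drawn, in the tangent
    plane, from the apex [(sn, 0)] with slope [T]. The conclusion states this
    for the combination of [x] and [y] that lies on the line. In polar
    coordinates around the centre, being longer than a leg bounds the sum of the
    elevations of [x] and [y], and [half_angle_bounds] applies. *)
Lemma crossing_low c (T x0 x1 x2 y0 y1 y2 : R) : 0 < T -> T ^+ 2 * (1 + kap) = 1 - kap ->
  0 <= c -> c * C <= kap * sn -> C <= x0 -> C <= y0 ->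
  x0 ^+ 2 + x1 ^+ 2 + x2 ^+ 2 = 1 -> y0 ^+ 2 + y1 ^+ 2 + y2 ^+ 2 = 1 ->
  x1 + c * x0 < 0 -> 0 < y1 + c * y0 -> 0 <= x2 -> 0 <= y2 ->
  x0 * y0 + x1 * y1 + x2 * y2 < C ^+ 2 - sn ^+ 2 * kap ->
  C * ((y1 + c * y0) * x2 - (x1 + c * x0) * y2) <=
  (sn + c * C) * T * ((y1 + c * y0) * x0 - (x1 + c * x0) * y0).
Proof.
move=> T0 TE c0 cC hx hy ex ey lx ly x20 y20 hd.
have x00 : 0 < x0 by rewrite (lt_le_trans C0).
have y00 : 0 < y0 by rewrite (lt_le_trans C0).
have x1n : x1 < 0.
  have : 0 <= c * x0 by rewrite mulr_ge0 // ltW.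
  by move: lx; slim; lra.
have CC : C ^+ 2 <= x0 * y0 by rewrite expr2; apply: ler_pM => //; exact: ltW.
have sk : 0 <= sn ^+ 2 * kap by rewrite mulr_ge0 // sqr_ge0.
have xy2 : 0 <= x2 * y2 by rewrite mulr_ge0.
have y1p : 0 < y1.
  rewrite ltNge; apply/negP => h; have : 0 <= x1 * y1 by rewrite mulr_le0 // ltW.
  by move: hd CC sk xy2; slim; lra.
have nx1 : 0 < - x1 by rewrite oppr_gt0.
have [r [ca [sa [r0 xE x2E [ca0 sa0 ea]]]]] := polar nx1 x20.
have [r' [cb [sb [r'0 yE y2E [cb0 sb0 eb]]]]] := polar y1p y20.
have x1E : x1 = - (r * ca) by rewrite -xE opprK.
have rs u0 u1 u2 (q cu su : R) : C <= u0 -> u0 ^+ 2 + u1 ^+ 2 + u2 ^+ 2 = 1 ->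
    0 < q -> u1 ^+ 2 = (q * cu) ^+ 2 -> u2 = q * su -> cu ^+ 2 + su ^+ 2 = 1 -> q <= sn.
  move=> hu eu q0 u1E u2E ecs; apply: le_of_sqr; first exact: ltW.
  have : C ^+ 2 <= u0 ^+ 2 by rewrite ler_pXn2r ?nnegrE // ltW // (lt_le_trans C0).
  have : q ^+ 2 = u1 ^+ 2 + u2 ^+ 2 by rewrite u1E u2E !exprMn -mulrDr ecs mulr1.
  by move: eu Csn; slim; lra.
have rsn : r <= sn by apply: (rs _ _ _ _ _ _ hx ex r0 _ x2E ea); rewrite x1E sqrrN.
have r'sn : r' <= sn by apply: (rs _ _ _ _ _ _ hy ey r'0 _ y2E eb); rewrite yE.
have hk : kap <= ca * cb - sa * sb.
  have rr : r * r' <= sn ^+ 2 by rewrite expr2; apply: ler_pM => //; exact: ltW.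
  have : (r * r') * kap <= sn ^+ 2 * kap by rewrite ler_wpM2r.
  have : x1 * y1 + x2 * y2 = - (r * r') * (ca * cb - sa * sb).
    by rewrite x1E x2E y2E yE; ring.
  move=> e h; rewrite -(ler_pM2l (mulr_gt0 r0 r'0)).
  by move: e h hd CC; slim; lra.
have [i1 i2 i3] := half_angle_bounds T0 TE ea eb (ltW ca0) sa0 (ltW cb0) sb0 hk.
have cC0 : 0 <= c * C by rewrite mulr_ge0 // ltW.
set d := c * C in cC cC0 *.
set P := (sn + d) * T * cb + d * sb; set Q := (sn + d) * T * ca - d * sa.
set N := sa * cb + ca * sb in i1.
have P0 : 0 <= P.
  have sd : 0 <= sn + d by rewrite addr_ge0 // ltW.
  apply: addr_ge0; last exact: mulr_ge0.
  by apply: mulr_ge0 (ltW cb0); apply: mulr_ge0 (ltW T0).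
have Q0 : 0 <= Q.
  have [h|h] := leP (T * ca) sa.
    have : d * (sa - T * ca) <= kap * sn * (sa - T * ca) by rewrite ler_wpM2r // subr_ge0.
    have : sn * (kap * sa) <= sn * ((1 + kap) * T * ca) by rewrite ler_wpM2l // ltW.
    by rewrite /Q; clearbody d; slim; lra.
  have h1 : 0 <= d * (T * ca - sa) by rewrite mulr_ge0 // subr_ge0 ltW.
  have h2 : 0 <= sn * (T * ca).
    by apply: mulr_ge0 (ltW sn0) _; apply: mulr_ge0 (ltW T0) (ltW ca0).
  by move: h1 h2; rewrite /Q; clearbody d; slim; lra.
have PQ : sn * N <= P + Q.
  have h1 : d * (sa - sb) <= d * (T * (ca + cb)) by rewrite ler_wpM2l.
  have h2 : sn * N <= sn * (T * (ca + cb)) by rewrite ler_wpM2l // ltW.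
  by move: h1 h2; rewrite /P /Q; clearbody d N; slim; lra.
have f1 : r' * (C * r) * P <= r' * (sn * x0) * P.
  rewrite ler_wpM2r // ler_wpM2l ?(ltW r'0) // mulrC.
  by apply: ler_pM => //; exact: ltW.
have f2 : r * (C * r') * Q <= r * (sn * y0) * Q.
  rewrite ler_wpM2r // ler_wpM2l ?(ltW r0) // mulrC.
  by apply: ler_pM => //; exact: ltW.
have f3 : C * r * r' * (sn * N) <= C * r * r' * (P + Q).
  rewrite ler_wpM2l //; apply: mulr_ge0 (ltW r'0); exact: mulr_ge0 (ltW C0) (ltW r0).
rewrite -subr_ge0 -(pmulr_rge0 _ sn0).
rewrite [X in 0 <= X](_ : _ = r' * (sn * x0) * P + r * (sn * y0) * Q - C * r * r' * (sn * N)).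
  by move: f1 f2 f3; clearbody P Q N; slim; lra.
by rewrite x1E x2E yE y2E /P /Q /N /d; ring.
Qed.

(** The point of the line reached in [crossing_low] still lies in the cap. *)
Lemma low_height (c1 s2 T : R) : 0 < T -> T ^+ 2 * (1 + kap) = 1 - kap ->
  0 <= c1 -> c1 <= kap * sn -> 0 < s2 -> s2 ^+ 2 = sn ^+ 2 - c1 ^+ 2 ->
  (sn + c1) * T <= s2.
Proof.
move=> T0 TE c10 c1k s20 s2E; apply: le_of_sqr; first exact: ltW.
have q0 : 0 < sn + c1 by rewrite ltr_pwDl.
have k1p : 0 < 1 + kap by rewrite ltr_pwDl.
rewrite -(ler_pM2r k1p) exprMn -mulrA TE s2E subr_sqr.
have h : (sn + c1) * (1 - kap) <= (sn - c1) * (1 + kap) by move: c1k; slim; lra.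
have := ler_wpM2l (ltW q0) h; clear h; set q := sn + c1; set r := sn - c1.
by move=> h; rewrite expr2 -!mulrA (mulrC r); move: h; rewrite !mulrA (mulrAC q _ r) // mulrAC.
Qed.

(** On the line at offset [c1], the segment from the lower end of the chord to
    the height [w] of [crossing_low] is at most the base. In the plane the
    base exceeds it by at least [1 - 2 * kap] times [s2 - w]; the spherical
    correction is a multiple of [s2 - w] too, but of order [sn ^+ 2], so that it
    is absorbed as long as [kap] stays away from [1 / 2]. *)
Lemma low_segment (c1 s2 T w n : R) : 0 < T -> T ^+ 2 * (1 + kap) = 1 - kap ->
  0 <= c1 -> c1 <= kap * sn -> 0 < s2 -> s2 ^+ 2 = sn ^+ 2 - c1 ^+ 2 ->
  w = (sn + c1) * T -> 0 < n -> n ^+ 2 = C ^+ 2 + c1 ^+ 2 + w ^+ 2 ->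
  cosbase sn kap * n <= C ^+ 2 + c1 ^+ 2 - s2 * w.
Proof.
move=> T0 TE c10 c1k s20 s2E wE n0 nE.
have q0 : 0 < sn + c1 by rewrite ltr_pwDl.
have [t [t0 s2t tE]] : exists t, [/\ 0 < t, s2 = (sn + c1) * t & t ^+ 2 * (sn + c1) = sn - c1].
  exists (s2 / (sn + c1)); split; [by rewrite divr_gt0|by field; rewrite gt_eqF|].
  rewrite expr_div_n s2E subr_sqr; field; by rewrite gt_eqF.
have Tt : T <= t.
  apply: le_of_sqr; first exact: ltW.
  have k1p : 0 < 1 + kap by rewrite ltr_pwDl.
  rewrite -(ler_pM2r (mulr_gt0 k1p q0)).
  have -> : T ^+ 2 * ((1 + kap) * (sn + c1)) = (1 - kap) * (sn + c1) by rewrite -TE; ring.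
  have -> : t ^+ 2 * ((1 + kap) * (sn + c1)) = (1 + kap) * (sn - c1) by rewrite -tE; ring.
  by move: c1k; slim; lra.
set q := sn + c1 in q0 s2t tE wE.
set F := 1 + kap in TE.
have qt : q * (1 + t ^+ 2) = 2 * sn by move: tE; rewrite /q; slim; lra.
have FT : F * (1 + T ^+ 2) = 2 by move: TE; rewrite /F; slim; lra.
(* In the plane the base, 2 sn F T, exceeds the segment, s2 + w, by
   m (s2 - w). *)
set m := F * (2 * T * t - 1 + T ^+ 2) / 2.
have mE : 2 * sn * F * T - q * (t + T) = q * (t - T) * m.
  apply/eqP; rewrite -subr_eq0; apply/eqP.
  transitivity ((2 * sn - q * (1 + t ^+ 2)) * F * T + q * (t + T) / 2 * (F * (1 + T ^+ 2) - 2)).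
    by rewrite /m; field.
  by rewrite qt FT; ring.
have m1 : 1 / 50 <= m.
  have h : F * T * T <= F * T * t.
    by rewrite ler_wpM2l // mulr_ge0 ?(ltW T0) // /F addr_ge0.
  have -> : m = F * T * t - F / 2 + (T ^+ 2 * F) / 2 by rewrite /m; field.
  rewrite TE /F in h *; move: h TE; rewrite /F expr2; slim; lra.
have g0 : 0 <= s2 ^+ 2 - w ^+ 2.
  by rewrite s2t wE subr_ge0 ler_pXn2r ?nnegrE ?mulr_ge0 ?(ltW q0) ?(ltW t0) ?(ltW T0) // ler_wpM2l // ltW.
set g := s2 ^+ 2 - w ^+ 2 in g0.
have nE' : n ^+ 2 = 1 - g by rewrite nE /g s2E; move: Csn; slim; lra.
have ng : n <= 1 - g / 2.
  have g1 : g <= 1 by have := sqr_ge0 n; rewrite nE'; clearbody g; slim; lra.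
  apply: le_of_sqr; first by move: g1; clearbody g; slim; lra.
  by rewrite nE'; have := sqr_ge0 g; clearbody g; rewrite !expr2; slim; lra.
set G := 2 * sn ^+ 2 * (1 - kap ^+ 2).
have GE : G = 2 * (sn * F * T) ^+ 2.
  by transitivity (2 * sn ^+ 2 * (1 + kap) * (T ^+ 2 * F)); [rewrite TE /G; ring|rewrite /F; ring].
have G1 : G <= 2 / 100.
  have : sn ^+ 2 * (1 - kap ^+ 2) <= sn ^+ 2 by rewrite ler_piMr ?sqr_ge0 // gerBl sqr_ge0.
  by rewrite /G; move: sn_small; slim; lra.
have G0 : 0 <= G by rewrite GE mulr_ge0 ?sqr_ge0.
suff main : (s2 + w) ^+ 2 <= G * (2 - g).
  have hG : 0 <= 1 - G by move: G1; clearbody G; slim; lra.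
  have : (1 - G) * n <= (1 - G) * (1 - g / 2) by rewrite ler_wpM2l.
  have -> : cosbase sn kap = 1 - G by [].
  have -> : C ^+ 2 + c1 ^+ 2 - s2 * w = 1 - (s2 + w) ^+ 2 / 2 - g / 2.
    by rewrite /g; move: Csn s2E; rewrite !expr2; slim; lra.
  by move: main; clearbody G g; slim; lra.
set a := q * (t + T); set b := q * (t - T).
have a0 : 0 <= a by rewrite mulr_ge0 ?addr_ge0 // ltW.
have b0 : 0 <= b by rewrite mulr_ge0 ?subr_ge0 // ltW.
have gE : g = a * b by rewrite /g s2t wE /a /b; ring.
have -> : (s2 + w) ^+ 2 = a ^+ 2 by rewrite s2t wE /a; ring.
have hm : 2 * (sn * F * T) = a + b * m by rewrite /a /b -mE; ring.
have GE' : 2 * G = (a + b * m) ^+ 2 by rewrite -hm GE; ring.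
have h1 : 0 <= b * m * (2 * a + b * m) - G * (a * b).
  have -> : b * m * (2 * a + b * m) - G * (a * b) = b * (a * (2 * m - G) + b * m * m) by ring.
  have m0 : 0 <= m by move: m1; clearbody m; slim; lra.
  apply: mulr_ge0 => //; apply: addr_ge0; last by apply: mulr_ge0 => //; apply: mulr_ge0.
  by apply: mulr_ge0 => //; move: m1 G1; clearbody m G; slim; lra.
rewrite gE; move: h1 GE'; clearbody a b m G; rewrite !expr2; slim; lra.
Qed.

End CapInequalities3.

(** * Orthonormal frames *)

Section Frame.
Variables (R : realType) (o e1 e2 : 'rV[R]_3).
Implicit Types (x y : 'rV[R]_3) (a b c : R).

Definition orthonormal : Prop :=
  [/\ S2 o, S2 e1, S2 e2 & [/\ dot o e1 = 0, dot o e2 = 0 & dot e1 e2 = 0]].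

Hypothesis fr : orthonormal.

(** The matrix with rows [o], [e1], [e2] is orthogonal. *)
Lemma frame_dot x y :
  dot x y = dot o x * dot o y + dot e1 x * dot e1 y + dot e2 x * dot e2 y.
Proof.
have mulE u v : (u *m v^T) 0 0 = dot u v :> R.
  by rewrite mxE; apply: eq_bigr => i _; rewrite mxE.
case: fr; rewrite /S2 /= => ho h1 h2 [h3 h4 h5].
pose Q : 'M[R]_3 := \matrix_(i < 3) [:: o; e1; e2]`_i.
have QE (i : 'I_3) : row i Q = [:: o; e1; e2]`_i by rewrite rowK.
have QQ : Q *m Q^T = 1%:M.
  apply/matrixP => i j; rewrite -[LHS]/((Q *m Q^T) i j).
  have -> : (Q *m Q^T) i j = dot [:: o; e1; e2]`_i [:: o; e1; e2]`_j.
    by rewrite -!QE mxE; apply: eq_bigr => k _; rewrite !mxE.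
  rewrite mxE; case: i => [[|[|[|//]]]] ?; case: j => [[|[|[|//]]]] ? /=;
    by rewrite /= -?val_eqE /= ?(dotC e1 o) ?(dotC e2 o) ?(dotC e2 e1).
have QQ' : Q^T *m Q = 1%:M by apply: mulmx1C.
rewrite -mulE -[X in X *m _]mulmx1 -QQ' mulmxA -mulmxA.
rewrite mxE !big_ord_recl big_ord0 addr0 addrA.
have coord z (i : 'I_3) : (z *m Q^T) 0 i = dot [:: o; e1; e2]`_i z.
  by rewrite -QE mxE; apply: eq_bigr => k _; rewrite !mxE mulrC.
have coord' z (i : 'I_3) : (Q *m z^T) i 0 = dot [:: o; e1; e2]`_i z.
  by rewrite -QE mxE; apply: eq_bigr => k _; rewrite !mxE.
by rewrite !coord !coord'.
Qed.

Lemma frame_eq x y : dot o x = dot o y -> dot e1 x = dot e1 y ->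
  dot e2 x = dot e2 y -> x = y.
Proof.
move=> h0 h1 h2; apply/eqP; rewrite -subr_eq0; apply/eqP/dot_eq0.
by rewrite frame_dot !dotL h0 h1 h2 !subrr !mulr0 !addr0.
Qed.

Definition point a b c := a *: o + b *: e1 + c *: e2.

Lemma point_coords a b c :
  [/\ dot o (point a b c) = a, dot e1 (point a b c) = b & dot e2 (point a b c) = c].
Proof.
case: fr; rewrite /S2 /= => ho h1 h2 [h3 h4 h5].
rewrite /point !dotL ho h1 h2 (dotC e1 o) (dotC e2 o) (dotC e2 e1) h3 h4 h5.
by rewrite !mulr1 !mulr0 !addr0 !add0r.
Qed.

Lemma point_S2 a b c : a ^+ 2 + b ^+ 2 + c ^+ 2 = 1 -> S2 (point a b c).
Proof. by move=> h; rewrite /S2 /= frame_dot; have [-> -> ->] := point_coords a b c. Qed.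

Lemma S2_coords x : S2 x -> dot o x ^+ 2 + dot e1 x ^+ 2 + dot e2 x ^+ 2 = 1.
Proof. by rewrite /S2 /= frame_dot !expr2. Qed.

End Frame.

Section Cross.
Variable R : realType.
Implicit Types x y z o e : 'rV[R]_3.

Definition cross x y : 'rV[R]_3 :=
  \row_i [:: x 0 1 * y 0 2%:R - x 0 2%:R * y 0 1; x 0 2%:R * y 0 0 - x 0 0 * y 0 2%:R;
             x 0 0 * y 0 1 - x 0 1 * y 0 0]`_i.

Lemma cross_dot x y z : dot (cross x y) z =
  (x 0 1 * y 0 2%:R - x 0 2%:R * y 0 1) * z 0 0 +
  (x 0 2%:R * y 0 0 - x 0 0 * y 0 2%:R) * z 0 1 +
  (x 0 0 * y 0 1 - x 0 1 * y 0 0) * z 0 2%:R.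
Proof. by rewrite dotE !mxE. Qed.

Lemma cross_dotl x y : dot (cross x y) x = 0.
Proof. by rewrite cross_dot; ring. Qed.

Lemma cross_dotr x y : dot (cross x y) y = 0.
Proof. by rewrite cross_dot; ring. Qed.

Lemma cross_norm x y : dot (cross x y) (cross x y) = dot x x * dot y y - dot x y ^+ 2.
Proof. by rewrite cross_dot !mxE /= !dotE; ring. Qed.

Lemma orthonormal_complete o e1 : S2 o -> S2 e1 -> dot o e1 = 0 -> orthonormal o e1 (cross o e1).
Proof.
move=> So S1 h; split=> //.
  move: So S1; rewrite /S2 /= cross_norm h => -> ->; by rewrite mulr1 expr0n subr0.
by split=> //; rewrite dotC ?cross_dotl ?cross_dotr.
Qed.

Lemma normalize x : 0 < dot x x -> exists2 k, 0 < k & S2 (k *: x).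
Proof.
move=> h; exists (Num.sqrt (dot x x))^-1; first by rewrite invr_gt0 sqrtr_gt0.
by rewrite /S2 /= dotZl dotZr mulrA -expr2 exprVn sqr_sqrtr ?mulVf ?gt_eqF // ltW.
Qed.

Lemma frame_exists o : S2 o -> exists e1 e2, orthonormal o e1 e2.
Proof.
move=> So; have [x hx] : exists x, 0 < dot (cross o x) (cross o x).
  have h y (i : 'I_3) : dot y (delta_mx 0 i) = y 0 i.
    rewrite /dot (bigD1 i) //= big1 => [|j /negPf ji]; last by rewrite mxE ji andbF mulr0.
    by rewrite mxE !eqxx mulr1 addr0.
  have small : o 0 0 ^+ 2 < 1 \/ o 0 1 ^+ 2 < 1.
    have := So; rewrite /S2 /= dotE => e; have := sqr_ge0 (o 0 2%:R).
    by have [?|?] := ltP (o 0 0 ^+ 2) 1; [left|right; lra].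
  have So1 : dot o o = 1 := So.
  case: small => lt1; [exists (delta_mx 0 0)|exists (delta_mx 0 1)];
    by rewrite cross_norm !h mxE So1 mulr1 subr_gt0.
have [k k0 S1] := normalize hx.
exists (k *: cross o x), (cross o (k *: cross o x)); apply: orthonormal_complete => //.
by rewrite dotZr dotC cross_dotl mulr0.
Qed.

End Cross.

(** * Edges relative to the line through the longest edge *)

(** The longest edge [A B] lies on a great circle, the line. The frame is chosen
    with [e2] parallel to the line, so that the upper half [0 < dot e2 x] of the
    cap contains [A] and the lower half contains [B]. The points [A'] and [B']
    are the upper and lower ends of the chord that the line cuts from the cap,
    and [M] is its midpoint. *)

Section Chord.
Variables (R : realType) (o e1 e2 A B : 'rV[R]_3) (C sn kap c : R).
Implicit Types (p q u v w x y z : 'rV[R]_3).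
Hypothesis fr : orthonormal o e1 e2.
Hypotheses (C0 : 0 < C) (sn0 : 0 < sn).
Hypotheses (Csn : C ^+ 2 + sn ^+ 2 = 1) (sn_small : sn ^+ 2 <= 1 / 100).
Hypotheses (kap0 : 0 <= kap) (kap1 : kap <= 49 / 100).
Hypothesis hc : - (kap * sn) <= c * C <= kap * sn.

Let D := cap o C.
Let base := acos (cosbase sn kap).
Let leg := acos (cosleg sn kap).
Let So : S2 o. Proof. by case: fr. Qed.

(** The line is the zero set of [side]. *)
Definition side x := dot e1 x + c * dot o x.
(** Gnomonic coordinate along the line, in which arcs of the line are
    intervals. *)
Definition height x := dot e2 x / dot o x.
Definition on_line x := D x /\ side x = 0.

Hypotheses (LA : on_line A) (LB : on_line B).
Hypotheses (A2 : 0 < dot e2 A) (B2 : dot e2 B < 0).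
Hypothesis AB : sdist A B = base.

Let coords x : D x -> dot o x ^+ 2 + dot e1 x ^+ 2 + dot e2 x ^+ 2 = 1.
Proof. by move=> h; apply: S2_coords => //; case: h. Qed.

Let o_gt0 x : D x -> 0 < dot o x. Proof. by case=> _; apply: lt_le_trans. Qed.

Lemma side0 x : side x = 0 -> dot e1 x = - (c * dot o x).
Proof. by rewrite /side => /eqP; rewrite addr_eq0 => /eqP. Qed.

Lemma sideL s x t y : side (s *: x + t *: y) = s * side x + t * side y.
Proof. by rewrite /side !dotL; ring. Qed.

Lemma height_gt0 x : D x -> (0 < height x) = (0 < dot e2 x).
Proof. by move=> h; rewrite /height pmulr_lgt0 // invr_gt0 o_gt0. Qed.

Lemma height_lt0 x : D x -> (height x < 0) = (dot e2 x < 0).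
Proof. by move=> h; rewrite /height pmulr_llt0 // invr_gt0 o_gt0. Qed.

Lemma height_ge0 x : D x -> (0 <= height x) = (0 <= dot e2 x).
Proof. by move=> h; rewrite /height pmulr_lge0 // invr_gt0 o_gt0. Qed.

Lemma line_between u v w : on_line u -> on_line v -> on_line w ->
  height w <= height u -> height u <= height v -> height w < height v ->
  segment v w u.
Proof.
move=> [Du su] [Dv sv] [Dw sw] h1 h2 h3.
have u0 := o_gt0 Du; have v0 := o_gt0 Dv; have w0 := o_gt0 Dw.
set d := height v - height w; have d0 : 0 < d by rewrite subr_gt0.
split; first exact: Du.1.
exists ((height u - height w) / d * (dot o u / dot o v)),
  ((height v - height u) / d * (dot o u / dot o w)).
have f1 : 0 <= (height u - height w) / d by apply: divr_ge0 (ltW d0); rewrite subr_ge0.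
have f2 : 0 <= (height v - height u) / d by apply: divr_ge0 (ltW d0); rewrite subr_ge0.
split; [exact: mulr_ge0 f1 (divr_ge0 (ltW u0) (ltW v0))|exact: mulr_ge0 f2 (divr_ge0 (ltW u0) (ltW w0))|].
have o1 : dot o u = (height u - height w) / d * (dot o u / dot o v) * dot o v +
    (height v - height u) / d * (dot o u / dot o w) * dot o w.
  have : height v - height w != 0 by rewrite gt_eqF.
  by rewrite /d => d0'; field; rewrite d0' !gt_eqF.
apply: (frame_eq fr); rewrite !dotL //.
- by rewrite (side0 su) (side0 sv) (side0 sw) {1}o1; ring.
- have hE x : 0 < dot o x -> dot e2 x = height x * dot o x.
    by move=> x0; rewrite /height divfK // gt_eqF.
  rewrite (hE _ u0) (hE _ v0) (hE _ w0).
  have : height v - height w != 0 by rewrite gt_eqF.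
  by rewrite /d => d0'; field; rewrite d0' !gt_eqF.
Qed.

Variables (s2 : R) (A' B' M : 'rV[R]_3).
Hypotheses (s2_gt0 : 0 < s2) (s2E : s2 ^+ 2 = sn ^+ 2 - (c * C) ^+ 2).
Hypothesis topE : [/\ dot o A' = C, dot e1 A' = - (c * C) & dot e2 A' = s2].
Hypothesis botE : [/\ dot o B' = C, dot e1 B' = - (c * C) & dot e2 B' = - s2].
Hypotheses (LA' : on_line A') (LB' : on_line B') (LM : on_line M) (M2 : dot e2 M = 0).

Let DA' : D A' := LA'.1.
Let DB' : D B' := LB'.1.
Let DM : D M := LM.1.
Let DA : D A := LA.1.
Let DB : D B := LB.1.

Lemma height_ends u : on_line u -> height B' <= height u <= height A'.
Proof.
move=> [Du su]; have [h0 _ h2] := topE; have [k0 _ k2] := botE.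
have u0 := o_gt0 Du; rewrite /height h0 h2 k0 k2 mulNr -ler_norml.
have sp : 0 < s2 / C by rewrite divr_gt0.
rewrite -(ler_pXn2r (n := 2)) ?nnegrE ?(ltW sp) // real_normK ?num_real //.
rewrite !expr_div_n ler_pdivrMr ?exprn_gt0 // mulrAC ler_pdivlMr ?exprn_gt0 //.
rewrite s2E; have := coords Du; rewrite (side0 su) => e.
have hu : C ^+ 2 <= dot o u ^+ 2 by rewrite ler_pXn2r ?nnegrE ?(ltW C0) ?(ltW u0) //; case: Du.
set x := dot o u in e hu *; set y := dot e2 u in e *.
have -> : y ^+ 2 = 1 - x ^+ 2 - (c * x) ^+ 2 by move: e; rewrite sqrrN; lra.
have -> : sn ^+ 2 = 1 - C ^+ 2 by move: Csn; lra.
rewrite -subr_ge0 [X in 0 <= X](_ : _ = x ^+ 2 - C ^+ 2); last by ring.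
by rewrite subr_ge0.
Qed.

(** Two points that the line and its perpendicular bisector do not separate are
    at most a leg apart. *)
Lemma quarter_dist x y : D x -> D y -> 0 <= side x * side y ->
  0 <= dot e2 x * dot e2 y -> sdist x y <= leg.
Proof.
move=> Dx Dy hs h2; have /andP[l1 _] : 1 / 2 <= cosleg sn kap <= 1.
  by apply: cosleg_bounds; rewrite // kap0; move: kap1; lra.
apply: (sdist_le_dot Dx Dy); first by move: l1; lra.
have -> : cosleg sn kap = C ^+ 2 - sn ^+ 2 * kap by rewrite /cosleg; move: Csn; lra.
rewrite (frame_dot fr).
have cx := coords Dx; have cy := coords Dy.
have [sx|sx] := leP 0 (side x); have [sy|sy] := leP 0 (side y).
- exact: (quarter_dot C0 sn0 Csn sn_small kap0 kap1 hc Dx.2 Dy.2 cx cy sx sy h2).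
- have x0 : side x = 0 by nra.
  have hc' : - (kap * sn) <= - c * C <= kap * sn by rewrite mulNr lerN2 lerNl andbC.
  rewrite -(mulrNN (dot e1 x)).
  apply: (quarter_dot C0 sn0 Csn sn_small kap0 kap1 hc' Dx.2 Dy.2 _ _ _ _ h2); rewrite ?sqrrN //.
  + by move: x0; rewrite /side; lra.
  + by move: sy; rewrite /side; lra.
- have y0 : side y = 0 by nra.
  have hc' : - (kap * sn) <= - c * C <= kap * sn by rewrite mulNr lerN2 lerNl andbC.
  rewrite -(mulrNN (dot e1 x)).
  apply: (quarter_dot C0 sn0 Csn sn_small kap0 kap1 hc' Dx.2 Dy.2 _ _ _ _ h2); rewrite ?sqrrN //.
  + by move: sx; rewrite /side; lra.
  + by move: y0; rewrite /side; lra.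
- have hc' : - (kap * sn) <= - c * C <= kap * sn by rewrite mulNr lerN2 lerNl andbC.
  rewrite -(mulrNN (dot e1 x)).
  apply: (quarter_dot C0 sn0 Csn sn_small kap0 kap1 hc' Dx.2 Dy.2 _ _ _ _ h2); rewrite ?sqrrN //.
  + by move: sx; rewrite /side; lra.
  + by move: sy; rewrite /side; lra.
Qed.

Let kap01 : 0 <= kap <= 1. Proof. by rewrite kap0; move: kap1; lra. Qed.

Lemma leg_lt_base : leg < base.
Proof.
have ib := cosbase_bounds sn_small kap01; have /andP[l1 l2] := cosleg_bounds sn_small kap01.
have il : -1 <= cosleg sn kap <= 1 by rewrite l2 andbT; move: l1; lra.
rewrite ltNge; apply/negP => /(acos_le_inv il ib).
rewrite /cosleg /cosbase => h.
have : 0 < sn ^+ 2 * ((1 + kap) * (1 - 2 * kap)).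
  by rewrite mulr_gt0 ?exprn_gt0 // mulr_gt0 //; move: kap0 kap1; lra.
by move: h; rewrite !expr2; lra.
Qed.

Lemma height_AB : height B < 0 < height A.
Proof. by rewrite height_lt0 ?height_gt0 ?A2 ?B2. Qed.

Lemma side_sum u v w : on_line w -> on_line v -> on_line u ->
  height w <= height u -> height u <= height v -> height w < height v ->
  sdist v w = sdist v u + sdist u w.
Proof.
move=> Lw Lv Lu h1 h2 h3.
have hs := line_between Lu Lv Lw h1 h2 h3.
exact: (segment_sdist So C0 Csn sn_small Lv.1 Lw.1 hs).
Qed.

Lemma base_le v w : on_line v -> on_line w -> height A <= height v ->
  height w <= height B -> base <= sdist v w.
Proof.
move=> Lv Lw hv hw; have /andP[hB hA] := height_AB.
have hBA : height B < height A by apply: lt_trans hA.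
have f1 := side_sum Lw Lv LA (le_trans hw (ltW hBA)) hv (le_lt_trans hw (lt_le_trans hBA hv)).
have f2 := side_sum Lw LA LB hw (ltW hBA) (le_lt_trans hw hBA).
rewrite f1 f2 AB addrCA lerDl; apply: addr_ge0.
  exact: (sdist_ge0 Lv.1.1 DA.1).
exact: (sdist_ge0 DB.1 Lw.1.1).
Qed.

Lemma base_lt v : on_line v -> height A < height v -> base < sdist v B.
Proof.
move=> Lv hv; have /andP[hB hA] := height_AB.
have hBA : height B < height A by apply: lt_trans hA.
rewrite (side_sum LB Lv LA (ltW hBA) (ltW hv) (lt_trans hBA hv)) AB ltrDr.
apply: (sdist_gt0 Lv.1 DA) => e; by rewrite e ltxx in hv.
Qed.

Lemma nearer_upper y z : D y -> on_line z -> 0 <= dot e2 y -> 0 <= dot e2 z ->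
  sdist y z <= sdist y B'.
Proof.
move=> Dy Lz y2 z2; apply: (sdist_le Dy Lz.1 Dy DB').
have [h0 h1 h2] := botE; rewrite !(frame_dot fr y) h0 h1 h2 (side0 Lz.2) !mulrN.
exact: (above_base_dot C0 sn0 Csn sn_small kap0 kap1 hc (ltW s2_gt0) Dy.2 Lz.1.2 (coords Dy) y2 z2).
Qed.

(** An edge of a simple polygon can cross the line only beyond the ends of the
    longest edge. The condition is void for arcs on one side of the line. *)
Definition avoids x y := side x * side y < 0 ->
  forall q, segment x y q -> side q = 0 -> height A < height q \/ height q < height B.

Lemma crossing_point x y : D x -> D y -> side x * side y < 0 ->
  exists2 q, on_line q & segment x y q.
Proof.
move=> Dx Dy h; have x0 : side x != 0 by apply/eqP => e; move: h; rewrite e mul0r ltxx.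
have y0 : side y != 0 by apply/eqP => e; move: h; rewrite e mulr0 ltxx.
have xn : 0 < `|side x| by rewrite normr_gt0.
have yn : 0 < `|side y| by rewrite normr_gt0.
have [k k0 hq] := cone_segment C0 Dx Dy (ltW yn) (ltW xn) (addr_gt0 yn xn).
exists (k *: (`|side y| *: x + `|side x| *: y)) => //; split.
  exact: (segment_cap C0 Dx Dy hq).
rewrite -[_ *: _]addr0 -(scale0r x) sideL sideL mul0r addr0.
have [hx|hx] := ltP 0 (side x).
  have hy : side y < 0 by rewrite -(pmulr_rlt0 _ hx).
  by rewrite (gtr0_norm hx) (ltr0_norm hy); ring.
have hx' : side x < 0 by rewrite lt_neqAle x0.
have hy : 0 < side y by rewrite -(nmulr_rlt0 _ hx').
by rewrite (gtr0_norm hy) (ltr0_norm hx'); ring.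
Qed.

(** Points of the plane of the line are combinations of an upper point and of the
    lower end of the chord; the signs of the coefficients tell where they lie. *)
Lemma line_decomp z v : on_line z -> 0 < dot e2 z -> side v = 0 ->
  exists a b : R, v = a *: z + b *: B'.
Proof.
move=> [Dz sz] z2 sv; have z0 := o_gt0 Dz; have [h0 h1 h2] := botE.
have d0 : dot o z * s2 + dot e2 z * C != 0 by rewrite gt_eqF // addr_gt0 // mulr_gt0.
exists ((dot o v * s2 + dot e2 v * C) / (dot o z * s2 + dot e2 z * C)),
  ((dot o v * dot e2 z - dot e2 v * dot o z) / (dot o z * s2 + dot e2 z * C)).
apply: (frame_eq fr); rewrite !dotL ?(side0 sv) ?(side0 sz) ?h0 ?h1 ?h2.
- by field.
- by field.
- by field.
Qed.

Lemma bot_decomp z : on_line z -> 0 < dot e2 z ->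
  exists2 k, 0 < k & exists2 l, 0 < l & B' = k *: M - l *: z.
Proof.
move=> [Dz sz] z2; have z0 := o_gt0 Dz; have m0 := o_gt0 DM; have [h0 h1 h2] := botE.
exists ((C + s2 / dot e2 z * dot o z) / dot o M).
  by rewrite divr_gt0 // addr_gt0 // mulr_gt0 // divr_gt0.
exists (s2 / dot e2 z); first by rewrite divr_gt0.
have zn : dot e2 z != 0 by rewrite gt_eqF.
have mn : dot o M != 0 by rewrite gt_eqF.
apply: (frame_eq fr); rewrite !dotL ?(side0 sz) ?(side0 LM.2) ?h0 ?h1 ?h2 ?M2.
- by field; rewrite zn.
- by field; rewrite zn.
- by field; rewrite zn.
Qed.

(** As [y] lies above the bisector, [B'] can be traded for [M], which lies
    between [z] and [B']. *)
Lemma upper_in_triangle z y y' (a b d : R) : on_line z -> 0 < dot e2 z -> S2 y -> 0 < dot e2 y ->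
  dot e2 y' < 0 -> 0 <= b -> 0 <= d -> y = a *: z + b *: B' + d *: y' ->
  solid_triangle z M y' y.
Proof.
move=> Lz z2 Sy y2 y'2 b0 d0 yE; have [k k0 [l l0 BE]] := bot_decomp Lz z2.
have yE' : y = (a - b * l) *: z + (b * k) *: M + d *: y'.
  rewrite yE BE; apply: (frame_eq fr); rewrite !dotL; ring.
split=> //; exists (a - b * l), (b * k), d; split=> //.
  have : 0 < (a - b * l) * dot e2 z.
    have h : dot e2 y = (a - b * l) * dot e2 z + d * dot e2 y'.
      by rewrite {1}yE' !dotL M2 mulr0 addr0.
    have : d * dot e2 y' <= 0 by rewrite mulr_ge0_le0 // ltW.
    by move: y2; rewrite h; lra.
  by rewrite pmulr_lgt0 // => /ltW.
by rewrite mulr_ge0 // ltW.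
Qed.

(** Alternatives for an edge [y y'] from the upper to the lower half, seen from a
    point [z] of the line above [A]. If it crosses the line, it does so above [A]
    or below [B], and the first two alternatives follow from quasi-convexity of
    the distance. Otherwise the combination of [y] and [y'] lying in the plane
    of the line is written as [a z + b B']: according to the signs of [a] and
    [b], either [y'] is in the triangle [y z B'], or [y B'] and [z y'] cross, so
    that [crossing_exchange] applies, or [y] is in the triangle [z M y']. *)
Lemma descending_edge z y y' : on_line z -> height A <= height z ->
  D y -> D y' -> 0 < dot e2 y -> dot e2 y' < 0 -> sdist y y' <= base ->
  avoids y y' -> (side y = 0 -> height y <= height z) ->
  [\/ sdist y y' <= sdist y B', sdist z B <= sdist z y' | solid_triangle z M y' y].
Proof.
move=> Lz hz Dy Dy' y2 y'2 yy' av hy.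
have /andP[hB hA] := height_AB.
have z2 : 0 < dot e2 z by rewrite -(height_gt0 Lz.1) (lt_le_trans hA).
have Dz := Lz.1; have [B'0 B'1 B'2] := botE.
have hB'z := height_ends Lz; have hB'B := height_ends LB.
have hBz : height B < height z by rewrite (lt_trans hB) // (lt_le_trans hA).
have zy := nearer_upper Dy Lz (ltW y2) (ltW z2).
have B'neg : dot e2 B' < 0 by rewrite B'2 oppr_lt0.
have [opp|same] := ltP (side y * side y') 0.
  have [q Lq qs] := crossing_point Dy Dy' opp.
  case: (av opp q qs Lq.2) => hq.
    have hBA : height B < height A by apply: lt_trans hA.
    have qB' : base < sdist q B'.
      have /andP[hB1 _] := hB'B.
      rewrite (side_sum LB' Lq LB hB1 _ _); last exact: le_lt_trans hB1 (lt_trans hBA hq).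
        by apply: ltr_wpDr (base_lt Lq hq); apply: sdist_ge0 DB.1 DB'.1.
      exact: ltW (lt_trans hBA hq).
    case: (segment_far So C0 Csn sn_small DB' Dy Dy' qs) => h.
      by apply: Or31; rewrite (sdistC y B') (le_trans yy') // (le_trans _ h) // sdistC ltW.
    have : sdist B' y' <= leg.
      by apply: quarter_dist => //; [rewrite LB'.2 mul0r|rewrite mulr_le0 // ltW].
    move=> h'; have := lt_le_trans leg_lt_base (ltW qB').
    by rewrite sdistC ltNge (le_trans h).
  have zq : sdist z B <= sdist z q.
    rewrite (side_sum Lq Lz LB (ltW hq) (ltW hBz) (lt_trans hq hBz)) lerDl.
    exact: sdist_ge0 DB.1 Lq.1.1.
  case: (segment_far So C0 Csn sn_small Dz Dy Dy' qs) => h; last by apply: Or32; apply: le_trans h.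
  have h' : sdist z y <= leg.
    by apply: quarter_dist => //; [rewrite Lz.2 mul0r|rewrite mulr_ge0 // ltW].
  have := base_le Lz LB hz (lexx _); have := leg_lt_base.
  by move=> l1 l2; have := lt_le_trans l1 (le_trans l2 (le_trans zq (le_trans h h'))); rewrite ltxx.
have near_y : forall w, [\/ sdist y w <= sdist y z, sdist y w <= sdist y B' | sdist y w <= sdist y y] ->
    sdist y w <= sdist y B'.
  move=> w; case=> // h; first exact: le_trans zy.
  apply: le_trans h _; rewrite {1}/sdist; have := Dy.1; rewrite /S2 /= => ->.
  by rewrite acos1; apply: sdist_ge0 Dy.1 DB'.1.
have [y'0|y'0] := eqVneq (side y') 0.
  apply: Or31; have Ly' : on_line y' by [].
  have /andP[h1 _] := height_ends Ly'; have /andP[h2 h3] := hB'z.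
  have h4 : height y' < height z by rewrite (lt_trans _ (lt_le_trans hA hz)) // height_lt0.
  have hs := line_between Ly' Lz LB' h1 (ltW h4) (le_lt_trans h1 h4).
  by apply: near_y; case: (segment_far So C0 Csn sn_small Dy Dz DB' hs); [apply: Or31|apply: Or32].
have [y0|y0] := eqVneq (side y) 0.
  apply: Or33; have Ly : on_line y by [].
  have hM : height M = 0 by rewrite /height M2 mul0r.
  apply/(segment_solid y')/line_between; rewrite ?hM //.
  - by rewrite height_ge0 // ltW.
  - exact: hy.
  - exact: lt_le_trans hA hz.
have l0 : 0 < `|side y| by rewrite normr_gt0.
have l'0 : 0 < `|side y'| by rewrite normr_gt0.
set l := `|side y| in l0; set l' := `|side y'| in l'0.
have sv : side (l' *: y + (- l) *: y') = 0.
  rewrite sideL /l /l'; have [hp|hp] := ltP 0 (side y).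
    have hp' : 0 <= side y' by rewrite -(pmulr_rge0 _ hp).
    by rewrite (gtr0_norm hp) (ger0_norm hp'); ring.
  have hn : side y < 0 by rewrite lt_neqAle y0.
  have hn' : side y' <= 0 by rewrite -(nmulr_rge0 _ hn).
  by rewrite (ltr0_norm hn) (ler0_norm hn'); ring.
have [a [b vE]] := line_decomp Lz z2 sv.
have E : l' *: y = l *: y' + (a *: z + b *: B').
  by rewrite -vE scaleNr addrCA subrr addr0.
have ln : l != 0 by rewrite gt_eqF. have l'n : l' != 0 by rewrite gt_eqF.
have E2 : l' * dot e2 y = l * dot e2 y' + (a * dot e2 z - b * s2).
  by have := congr1 (dot e2) E; rewrite !dotL B'2 mulrN.
have [a0|a0] := ltP a 0; have [b0|b0] := leP b 0.
- apply/Or31/near_y.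
  have hs : solid_triangle z B' y y'.
    split; first exact: Dy'.1.
    exists (- a / l), (- b / l), (l' / l); split.
    + by rewrite divr_ge0 ?oppr_ge0 ?ltW.
    + by rewrite divr_ge0 ?oppr_ge0 // ltW.
    + by rewrite divr_ge0 ?ltW.
    + have -> : y' = l^-1 *: (l' *: y + (- a) *: z + (- b) *: B').
        by rewrite E !scaleNr -!addrA (addrC (a *: z)) -!addrA; apply: (frame_eq fr); rewrite !dotL; field.
      by apply: (frame_eq fr); rewrite !dotL; field.
  by case: (solid_far So C0 Csn sn_small Dy Dz DB' Dy hs); [apply: Or31|apply: Or32|apply: Or33].
- have : 0 < l' * dot e2 y by rewrite mulr_gt0.
  have : l * dot e2 y' < 0 by rewrite pmulr_rlt0.
  have : a * dot e2 z < 0 by rewrite pmulr_llt0.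
  have : 0 < b * s2 by rewrite mulr_gt0.
  by move: E2; lra.
- have b0' : 0 <= - b by rewrite oppr_ge0.
  have [k k0 hw] := cone_segment C0 Dy DB' (ltW l'0) b0' (ltr_wpDr b0' l'0).
  have hw' : segment z y' (k *: (l' *: y + - b *: B')).
    split; first exact: hw.1.
    exists (k * a), (k * l); split; rewrite ?mulr_ge0 ?(ltW k0) ?(ltW l0) //.
    by rewrite E; apply: (frame_eq fr); rewrite !dotL; ring.
  have := crossing_exchange So C0 Csn sn_small Dy Dy' Dz DB' hw hw'.
  have zB : sdist z B <= sdist z B'.
    have /andP[h1 _] := hB'B.
    rewrite (side_sum LB' Lz LB h1 (ltW hBz) (le_lt_trans h1 hBz)) lerDl.
    exact: sdist_ge0 DB.1 DB'.1.
  have [h|h] := leP (sdist y y') (sdist y B'); first by move=> _; apply: Or31.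
  move=> h'; apply: Or32; move: zB h h'; lra.
- apply: Or33; apply: (@upper_in_triangle z y y' (a / l') (b / l') (l / l')) => //.
  + exact: Dy.1.
  + by rewrite divr_ge0 // ltW.
  + by rewrite divr_ge0 // ltW.
  + have -> : y = l'^-1 *: (l' *: y) by rewrite scalerA mulVf // scale1r.
    by rewrite E; apply: (frame_eq fr); rewrite !dotL; field.
Qed.

(** The path from [z] to [y'] through [M] has each of its arcs in a quarter. *)
Lemma via_midpoint z y y' : D z -> D y' ->
  0 <= dot e2 z -> dot e2 y' <= 0 ->
  solid_triangle z M y' y -> sdist z y + sdist y y' <= 2 * leg.
Proof.
move=> Dz Dy' z2 y'2 hs; apply: le_trans (nested_path So C0 Csn sn_small Dz DM Dy' hs) _.
rewrite mulr_natl mulr2n; apply: lerD; apply: quarter_dist => //.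
- by rewrite LM.2 mulr0.
- by rewrite M2 mulr0.
- by rewrite LM.2 mul0r.
- by rewrite M2 mul0r.
Qed.

Lemma legs_base p q x : D p -> D q -> D x -> base <= sdist p q ->
  sdist x p + sdist x q <= 2 * leg.
Proof. by move=> Dp Dq Dx; apply: (legs_le So C0 Csn sn_small Dp Dq Dx kap01). Qed.

(** An edge descending from [y], together with the distance from [y] to the upper
    end of the chord: each alternative of [descending_edge] at [A'] reduces this
    to [legs_le] or to [via_midpoint]. *)
Lemma end_and_descending y y' : D y -> D y' -> 0 < dot e2 y -> dot e2 y' < 0 ->
  sdist y y' <= base -> avoids y y' -> sdist A' y + sdist y y' <= 2 * leg.
Proof.
move=> Dy Dy' y2 y'2 hb av.
have /andP[_ hA] := height_ends LA; have /andP[hB _] := height_ends LB.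
have A'2 : 0 <= dot e2 A' by case: topE => _ _ ->; exact: ltW.
have hy : side y = 0 -> height y <= height A'.
  by move=> y0; have /andP[] : height B' <= height y <= height A' by apply: height_ends.
case: (descending_edge LA' hA Dy Dy' y2 y'2 hb av hy) => h.
- apply: le_trans (legs_base DA' DB' Dy (base_le LA' LB' hA hB)).
  by rewrite sdistC lerD2l.
- rewrite sdistC; apply: (legs_base DA' Dy' Dy).
  exact: le_trans (base_le LA' LB hA (lexx _)) h.
- exact: (via_midpoint DA' Dy' A'2 (ltW y'2) h).
Qed.

(** The same as [end_and_descending] for an edge [x y] crossing the line at [z]
    above [A], when [x] is at least a base away from [B']. *)
Lemma around_half x y y' z : D x -> D y -> D y' -> on_line z -> segment x y z ->
  height A < height z -> 0 < dot e2 x -> 0 < dot e2 y -> dot e2 y' < 0 ->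
  side y != 0 -> sdist y y' <= base -> avoids y y' -> base <= sdist x B' ->
  sdist x y + sdist y y' <= 2 * leg.
Proof.
move=> Dx Dy Dy' Lz hs hz x2 y2 y'2 y0 hb av hx.
have hy : side y = 0 -> height y <= height z by move/eqP: y0.
case: (descending_edge Lz (ltW hz) Dy Dy' y2 y'2 hb av hy) => h.
- by apply: le_trans (legs_base Dx DB' Dy hx); rewrite sdistC lerD2l.
- have hzy : base < sdist y' z by rewrite sdistC; exact: lt_le_trans (base_lt Lz hz) h.
  case: (segment_far So C0 Csn sn_small Dy' Dx Dy hs) => h'.
    rewrite sdistC; apply: (legs_base Dx Dy' Dy).
    by rewrite sdistC; apply: le_trans (ltW hzy) h'.
  by have := lt_le_trans hzy h'; rewrite sdistC ltNge hb.
- case: hs => Sz [s [t [s0 t0 zE]]]; case: h => Sy [a [m [d [a0 m0 d0 yE]]]].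
  have z0 := o_gt0 Lz.1; have yy0 := o_gt0 Dy.
  have e : (1 - a * t) *: y = (a * s) *: x + m *: M + d *: y'.
    by rewrite scalerBl scale1r {1}yE zE; apply: (frame_eq fr); rewrite !dotL; ring.
  have o0 : (1 - a * t) * dot o y = a * s * dot o x + m * dot o M + d * dot o y'.
    by have := congr1 (dot o) e; rewrite !dotL.
  have p1 : 0 <= a * s * dot o x by rewrite !mulr_ge0 // ltW // o_gt0.
  have p2 : 0 <= m * dot o M by rewrite mulr_ge0 // ltW // o_gt0 //; case: LM.
  have p3 : 0 <= d * dot o y' by rewrite mulr_ge0 // ltW // o_gt0.
  have at1 : 0 <= 1 - a * t by rewrite -(pmulr_lge0 _ yy0) o0 !addr_ge0.
  have at0 : 1 - a * t != 0.
    apply/eqP => e0; move: o0; rewrite e0 mul0r => /esym/eqP.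
    rewrite paddr_eq0 ?addr_ge0 // paddr_eq0 // => /andP[/andP[_ /eqP m1] /eqP d1].
    have mz : m = 0 by apply/eqP; move/eqP: m1; rewrite mulf_eq0 [X in _ || X]gt_eqF ?orbF // o_gt0 //; case: LM.
    have dz : d = 0 by apply/eqP; move/eqP: d1; rewrite mulf_eq0 [X in _ || X]gt_eqF ?orbF // o_gt0.
    have ya : y = a *: z by rewrite {1}yE mz dz !scale0r !addr0.
    by move/eqP: y0; apply; rewrite ya -[_ *: _]addr0 -(scale0r z) sideL Lz.2 !mulr0 addr0.
  have pos : 0 < 1 - a * t by rewrite lt_neqAle eq_sym at0.
  apply: (via_midpoint Dx Dy' (ltW x2) (ltW y'2)); split=> //.
  exists (a * s / (1 - a * t)), (m / (1 - a * t)), (d / (1 - a * t)); split.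
  + by rewrite divr_ge0 ?mulr_ge0.
  + by rewrite divr_ge0.
  + by rewrite divr_ge0.
  + have -> : y = (1 - a * t)^-1 *: ((1 - a * t) *: y) by rewrite scalerA mulVf // scale1r.
    by rewrite e; apply: (frame_eq fr); rewrite !dotL; field.
Qed.

(** A lone edge [x y] of the upper half passing over [A] is compensated by one of
    its two neighbours. As its crossing with the line is farther than a base
    from [B'], so is one of [x] and [y], and [around_half] applies at the
    other end. *)
Lemma around_top x x' y y' : D x -> D x' -> D y -> D y' ->
  0 < dot e2 x -> dot e2 x' < 0 -> 0 < dot e2 y -> dot e2 y' < 0 ->
  side x * side y < 0 -> avoids x y -> avoids x x' -> avoids y y' ->
  sdist x x' <= base -> sdist y y' <= base ->
  sdist x y + sdist x x' <= 2 * leg \/ sdist x y + sdist y y' <= 2 * leg.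
Proof.
move=> Dx Dx' Dy Dy' x2 x'2 y2 y'2 opp av avx avy hx hy.
have [z Lz hs] := crossing_point Dx Dy opp.
have /andP[hB hA] := height_AB.
have z2 : 0 < dot e2 z.
  have z0 := o_gt0 Lz.1; case: hs => _ [s [t [s0 t0 zE]]].
  have ho : dot o z = s * dot o x + t * dot o y by rewrite zE !dotL.
  have he : dot e2 z = s * dot e2 x + t * dot e2 y by rewrite zE !dotL.
  rewrite lt_neqAle he eq_sym addr_ge0 ?mulr_ge0 ?(ltW x2) ?(ltW y2) // andbT.
  rewrite paddr_eq0 ?mulr_ge0 ?(ltW x2) ?(ltW y2) // !mulf_eq0.
  rewrite [dot e2 x == 0]gt_eqF // [dot e2 y == 0]gt_eqF // !orbF.
  by apply/negP => /andP[/eqP sz /eqP tz]; move: z0; rewrite ho sz tz !mul0r addr0 ltxx.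
have hz : height A < height z.
  case: (av opp z hs Lz.2) => // h.
  have : height z < 0 by apply: lt_trans hB.
  by rewrite (height_lt0 Lz.1) => /(lt_trans z2); rewrite ltxx.
have /andP[hB1 _] := height_ends LB.
have zB' : base <= sdist B' z.
  by rewrite sdistC; apply: (base_le Lz LB' (ltW hz) hB1).
have x0 : side x != 0 by apply/eqP => e; move: opp; rewrite e mul0r ltxx.
have y0 : side y != 0 by apply/eqP => e; move: opp; rewrite e mulr0 ltxx.
case: (segment_far So C0 Csn sn_small DB' Dx Dy hs) => h.
  right; apply: (around_half Dx Dy Dy' Lz hs hz) => //.
  by rewrite sdistC (le_trans zB').
left; rewrite sdistC; apply: (around_half Dy Dx Dx' Lz (segmentC hs) hz) => //.
by rewrite sdistC (le_trans zB').
Qed.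

(** An edge [p y] of the upper half on one side of the line is compensated by the
    other edge at its lower endpoint [p]: either directly, or after replacing
    [y] by the corner [A'], which is farther from [p]. *)
Lemma same_side_top p p' y : D p -> D p' -> D y -> 0 < dot e2 p ->
  dot e2 p <= dot e2 y -> dot e2 p' < 0 -> 0 <= side p * side y ->
  avoids p p' -> sdist p p' <= base -> sdist p y + sdist p p' <= 2 * leg.
Proof.
move=> Dp Dp' Dy p2 py p'2 hs av hb.
have key (d p1 y1 q1 : R) : - (kap * sn) <= d * C <= kap * sn ->
    (d * C) ^+ 2 = (c * C) ^+ 2 -> p1 * (d * C) = dot e1 p * (c * C) ->
    p1 * y1 = dot e1 p * dot e1 y -> p1 * q1 = dot e1 p * dot e1 p' ->
    p1 ^+ 2 = dot e1 p ^+ 2 -> y1 ^+ 2 = dot e1 y ^+ 2 -> q1 ^+ 2 = dot e1 p' ^+ 2 ->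
    0 <= p1 + d * dot o p -> 0 <= y1 + d * dot o y ->
    sdist p y + sdist p p' <= 2 * leg.
  move=> hd dE pd pyE pqE pE yE qE lp ly.
  have cp := coords Dp; have cy := coords Dy; have cq := coords Dp'.
  rewrite -pE in cp; rewrite -yE in cy; rewrite -qE in cq.
  have near : [\/ p1 < 0, p1 <= y1 | p1 ^+ 2 <= kap * sn ^+ 2] ->
      sdist p y + sdist p p' <= 2 * leg.
    move=> hcase; have /andP[l0 _] := cosleg_bounds sn_small kap01.
    apply: acos_sum_le; [exact: S2_dot_bounds Dp.1 Dy.1|exact: S2_dot_bounds Dp.1 Dp'.1|by move: l0; lra|].
    have -> : cosleg sn kap = C ^+ 2 - sn ^+ 2 * kap by rewrite /cosleg; move: Csn; lra.
    rewrite !(frame_dot fr p) -pyE -pqE.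
    exact: (lower_vertex_near C0 sn0 Csn sn_small kap0 kap1 hd Dp.2 Dp'.2 Dy.2 cp cq cy lp ly (ltW p2) py).
  have [h|h] := ltP p1 0; first by apply: near; apply: Or31.
  have [h1|h1] := leP p1 y1; first by apply: near; apply: Or32.
  have [h2|h2] := leP (p1 ^+ 2) (kap * sn ^+ 2); first by apply: near; apply: Or33.
  have p10 : 0 < p1.
    rewrite lt_neqAle h andbT; apply/eqP => e; move: h2.
    by rewrite -e expr0n /= ltNge mulr_ge0 // sqr_ge0.
  apply: le_trans (end_and_descending Dp Dp' p2 p'2 hb av); rewrite lerD2r.
  apply: (sdist_le Dp Dy DA' Dp); rewrite dotC; have [h3 h4 h5] := topE.
  rewrite !(frame_dot fr p) h3 h4 h5 mulrN -pd -pyE.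
  have s2d : s2 ^+ 2 = sn ^+ 2 - (d * C) ^+ 2 by rewrite dE.
  exact: (corner_farther C0 sn0 Csn sn_small kap0 kap1 hd (ltW s2_gt0) s2d Dp.2 Dy.2 cp cy ly (ltW p2) py p10 h1 h2).
have pos : 0 <= side p -> 0 <= side y -> sdist p y + sdist p p' <= 2 * leg.
  by move=> lp ly; apply: (key c (dot e1 p) (dot e1 y) (dot e1 p')).
have neg : side p <= 0 -> side y <= 0 -> sdist p y + sdist p p' <= 2 * leg.
  move=> lp ly; apply: (key (- c) (- dot e1 p) (- dot e1 y) (- dot e1 p'));
    rewrite ?sqrrN ?mulrNN //.
  - by rewrite mulNr lerN2 lerNl andbC.
  - by rewrite mulNr sqrrN.
  - by ring.
  - by move: lp; rewrite /side; lra.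
  - by move: ly; rewrite /side; lra.
have [lp|lp] := leP 0 (side p); have [ly|ly] := leP 0 (side y).
- exact: pos.
- by apply: neg (ltW ly); move: hs; nra.
- by apply: neg (ltW lp) _; move: hs; nra.
- exact: neg (ltW lp) (ltW ly).
Qed.

(** [crossing_low] for either orientation of the line. *)
Lemma crossing_height x y (T : R) : D x -> D y -> 0 <= dot e2 x -> 0 <= dot e2 y ->
  0 < T -> T ^+ 2 * (1 + kap) = 1 - kap ->
  side x < 0 -> 0 < side y -> dot x y < cosleg sn kap ->
  C * (side y * dot e2 x - side x * dot e2 y) <=
  (sn + `|c * C|) * T * (side y * dot o x - side x * dot o y).
Proof.
move=> Dx Dy x2 y2 T0 TE sx sy; have -> : cosleg sn kap = C ^+ 2 - sn ^+ 2 * kap.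
  by rewrite /cosleg; move: Csn; lra.
rewrite (frame_dot fr) => hd; have cx := coords Dx; have cy := coords Dy.
have [c0|c0] := leP 0 c.
  rewrite ger0_norm ?mulr_ge0 ?(ltW C0) //; case/andP: hc => _ hc'.
  exact: (crossing_low C0 sn0 Csn kap0 kap1 T0 TE c0 hc' Dx.2 Dy.2 cx cy sx sy x2 y2 hd).
have c0' : 0 <= - c by rewrite oppr_ge0 ltW.
have -> : `|c * C| = - c * C by rewrite normrM ltr0_norm // gtr0_norm.
have hc' : - c * C <= kap * sn by case/andP: hc; rewrite mulNr lerNl.
have cx' : dot o x ^+ 2 + (- dot e1 x) ^+ 2 + dot e2 x ^+ 2 = 1 by rewrite sqrrN.
have cy' : dot o y ^+ 2 + (- dot e1 y) ^+ 2 + dot e2 y ^+ 2 = 1 by rewrite sqrrN.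
have ly : - dot e1 y + - c * dot o y < 0 by move: sy; rewrite /side; lra.
have lx : 0 < - dot e1 x + - c * dot o x by move: sx; rewrite /side; lra.
have hd' : dot o y * dot o x + - dot e1 y * - dot e1 x + dot e2 y * dot e2 x <
    C ^+ 2 - sn ^+ 2 * kap by move: hd; rewrite mulrNN; lra.
have h := crossing_low C0 sn0 Csn kap0 kap1 T0 TE c0' hc' Dy.2 Dx.2 cy' cx' ly lx y2 x2 hd'.
by apply: le_trans (le_trans h _); rewrite le_eqVlt; apply/orP; left; apply/eqP; rewrite /side; ring.
Qed.

(** An edge [x y] of the upper half passing over [A] is at most a leg: if it were
    longer, it would cross the line so low, by [crossing_low], that the arc of
    the line from [B'] to the crossing would be at most the base, by
    [low_segment]. But this arc contains [A B] and its crossing end is above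
    [A]. *)
Lemma around_le_leg x y : D x -> D y -> 0 <= dot e2 x -> 0 <= dot e2 y ->
  side x * side y < 0 -> avoids x y -> sdist x y <= leg.
Proof.
move=> Dx Dy x2 y2 opp av; have /andP[l1 _] := cosleg_bounds sn_small kap01.
have [hd|hd] := leP (cosleg sn kap) (dot x y).
  by apply: (sdist_le_dot Dx Dy _ hd); move: l1; lra.
have [T T0 TE] : exists2 T, 0 < T & T ^+ 2 * (1 + kap) = 1 - kap.
  have k1 : 0 < 1 - kap by move: kap1; lra.
  have k2 : 0 < 1 + kap by move: kap0; lra.
  exists (Num.sqrt ((1 - kap) / (1 + kap))); first by rewrite sqrtr_gt0 divr_gt0.
  by rewrite sqr_sqrtr ?divfK ?gt_eqF // divr_ge0 // ltW.
have [q Lq hs] := crossing_point Dx Dy opp.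
have /andP[hB hA] := height_AB.
have q0 := o_gt0 Lq.1.
set w := (sn + `|c * C|) * T.
have low : C * dot e2 q <= w * dot o q /\ 0 <= dot e2 q.
  case: hs => _ [s [t [s0 t0 qE]]].
  have sq : s * side x + t * side y = 0 by rewrite -sideL -qE; case: Lq.
  have oq : dot o q = s * dot o x + t * dot o y by rewrite qE !dotL.
  have eq : dot e2 q = s * dot e2 x + t * dot e2 y by rewrite qE !dotL.
  split; last by rewrite eq addr_ge0 ?mulr_ge0.
  have scale r (u v a b : R) : 0 <= r -> C * u <= w * v -> a = r * u -> b = r * v -> C * a <= w * b.
    by move=> r0 h -> ->; rewrite mulrCA (mulrCA w) ler_wpM2l.
  have [sx|sx] := ltP (side x) 0.
    have sy : 0 < side y by rewrite -(nmulr_rlt0 _ sx).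
    have h := crossing_height Dx Dy x2 y2 T0 TE sx sy hd.
    have sn' : side y != 0 by rewrite gt_eqF.
    have tE : t = s / side y * - side x by rewrite -[LHS](mulfK sn'); move: sq => /eqP; rewrite addrC addr_eq0 => /eqP ->; field.
    apply: (scale (s / side y) _ _ _ _ _ h); first by rewrite divr_ge0 // ltW.
      by rewrite eq {1}tE; field.
    by rewrite oq {1}tE; field.
  have sx' : 0 < side x.
    by rewrite lt_neqAle sx andbT; apply/eqP => e; move: opp; rewrite -e mul0r ltxx.
  have sy : side y < 0 by rewrite -(pmulr_rlt0 _ sx').
  rewrite dotC in hd; have h := crossing_height Dy Dx y2 x2 T0 TE sy sx' hd.
  have sn' : side x != 0 by rewrite gt_eqF.
  have sE : s = t / side x * - side y by rewrite -[LHS](mulfK sn'); move: sq => /eqP; rewrite addr_eq0 => /eqP ->; field.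
  apply: (scale (t / side x) _ _ _ _ _ h); first by rewrite divr_ge0 // ltW.
    by rewrite eq {1}sE; field.
  by rewrite oq {1}sE; field.
have [low1 q2] := low.
have hAq : height A < height q.
  case: (av opp q hs Lq.2) => // h.
  by have := lt_trans h hB; rewrite (height_lt0 Lq.1) ltNge q2.
set c1 := `|c * C|.
have c10 : 0 <= c1 by exact: normr_ge0.
have c1k : c1 <= kap * sn by rewrite ler_norml.
have c1E : c1 ^+ 2 = (c * C) ^+ 2 by rewrite real_normK ?num_real.
have s2E' : s2 ^+ 2 = sn ^+ 2 - c1 ^+ 2 by rewrite c1E.
have ws2 : w <= s2 := low_height C0 sn0 kap0 kap1 T0 TE c10 c1k s2_gt0 s2E'.
have w0 : 0 <= w by rewrite mulr_ge0 ?addr_ge0 ?(ltW sn0) ?(ltW T0).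
set m := C ^+ 2 + c1 ^+ 2 + w ^+ 2.
have m0 : 0 < m by rewrite /m -addrA ltr_pwDl ?exprn_gt0 // addr_ge0 ?sqr_ge0.
have m1 : m <= 1.
  have : w ^+ 2 <= s2 ^+ 2 by rewrite ler_pXn2r ?nnegrE // ltW.
  by rewrite /m s2E'; move: Csn; lra.
have [n n0 nE] : exists2 n, 0 < n & n ^+ 2 = m.
  by exists (Num.sqrt m); rewrite ?sqrtr_gt0 // sqr_sqrtr // ltW.
have n1 : n <= 1 by apply: le_of_sqr => //; rewrite expr1n nE.
have nn : n != 0 by rewrite gt_eqF.
have [W0 W1 W2] := point_coords fr (C / n) (- (c * C) / n) (w / n).
set W := point o e1 e2 _ _ _ in W0 W1 W2.
have LW : on_line W.
  split; last by rewrite /side W0 W1; field.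
  split; last by rewrite W0 ler_pdivlMr // ler_piMr // ltW.
  apply: (point_S2 fr); rewrite !expr_div_n sqrrN -c1E -!mulrDl -/m nE divff //.
  by rewrite gt_eqF.
have hW : height W = w / C by rewrite /height W0 W2; field; rewrite nn gt_eqF.
have hqW : height q <= height W.
  by rewrite hW /height ler_pdivrMr // mulrAC ler_pdivlMr // mulrC.
have /andP[hB1 _] := height_ends LB.
have /andP[hB2 _] := height_ends Lq.
have hB3 : height B' < height W.
  by apply: (le_lt_trans hB1); apply: (lt_le_trans hB); rewrite hW divr_ge0 // ltW.
have e := side_sum LB' LW Lq hB2 hqW hB3.
have hBq : height B < height q by apply: lt_trans hAq; apply: lt_trans hA.
have e' := side_sum LB' Lq LB hB1 (ltW hBq) (le_lt_trans hB1 hBq).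
have far : base < sdist W B'.
  apply: lt_le_trans (base_lt Lq hAq) _; rewrite e e' addrCA lerDl.
  by apply: addr_ge0; [exact: sdist_ge0 LW.1.1 Lq.1.1|exact: sdist_ge0 DB.1 DB'.1].
have near : sdist W B' <= base.
  apply: (sdist_le_dot LW.1 DB'); first by have /andP[] := cosbase_bounds sn_small kap01.
  have [h0 h1 h2] := botE.
  rewrite (frame_dot fr W) W0 W1 W2 h0 h1 h2.
  have := low_segment C0 sn0 Csn sn_small kap0 kap1 T0 TE c10 c1k s2_gt0 s2E' (erefl w) n0 nE.
  rewrite -ler_pdivlMr // => h; apply: le_trans h _; rewrite le_eqVlt; apply/orP; left.
  by apply/eqP; rewrite c1E; field.
by move: far; rewrite ltNge near.
Qed.

End Chord.

(** * The frame of the longest edge *)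

Section Config.
Variables (R : realType) (o : 'rV[R]_3) (C sn kap : R).
Implicit Types (x y z e A B : 'rV[R]_3) (c : R).
Hypotheses (So : S2 o) (C0 : 0 < C) (sn0 : 0 < sn).
Hypotheses (Csn : C ^+ 2 + sn ^+ 2 = 1) (sn_small : sn ^+ 2 <= 1 / 100).
Hypotheses (kap0 : 0 <= kap) (kap1 : kap <= 49 / 100).

Let D := cap o C.
Let base := acos (cosbase sn kap).
Let leg := acos (cosleg sn kap).

(** The data of the previous part, with the points [A'], [B'] and [M] left to be
    determined by the line. *)
Definition config e1 e2 c A B : Prop :=
  [/\ orthonormal o e1 e2, - (kap * sn) <= c * C <= kap * sn,
      on_line o e1 C c A /\ on_line o e1 C c B,
      dot e2 B < 0 < dot e2 A & sdist A B = base].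

Lemma config_ends e1 e2 c A B : config e1 e2 c A B ->
  exists s2 A' B' M, [/\ 0 < s2, s2 ^+ 2 = sn ^+ 2 - (c * C) ^+ 2,
    [/\ dot o A' = C, dot e1 A' = - (c * C) & dot e2 A' = s2],
    [/\ dot o B' = C, dot e1 B' = - (c * C) & dot e2 B' = - s2] &
    [/\ on_line o e1 C c A', on_line o e1 C c B', on_line o e1 C c M & dot e2 M = 0]].
Proof.
case=> fr hc _ _ _.
have sq : 0 < sn ^+ 2 - (c * C) ^+ 2.
  rewrite subr_gt0; apply: le_lt_trans (_ : (kap * sn) ^+ 2 < _).
    rewrite -(real_normK (num_real (c * C))) ler_pXn2r ?nnegrE ?mulr_ge0 ?(ltW sn0) //.
    by rewrite ler_norml.
  rewrite ltr_pXn2r ?nnegrE ?mulr_ge0 ?(ltW sn0) //.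
  by rewrite gtr_pMl //; move: kap1; lra.
set s2 := Num.sqrt (sn ^+ 2 - (c * C) ^+ 2).
have s20 : 0 < s2 by rewrite sqrtr_gt0.
have s2E : s2 ^+ 2 = sn ^+ 2 - (c * C) ^+ 2 by rewrite sqr_sqrtr // ltW.
have [A0 A1 A2] := point_coords fr C (- (c * C)) s2.
have [B0 B1 B2] := point_coords fr C (- (c * C)) (- s2).
set A' := point o e1 e2 C (- (c * C)) s2 in A0 A1 A2.
set B' := point o e1 e2 C (- (c * C)) (- s2) in B0 B1 B2.
have DA : on_line o e1 C c A'.
  split; last by rewrite /side A0 A1 addNr.
  split; last by rewrite A0.
  by apply: (point_S2 fr); rewrite sqrrN s2E; move: Csn; lra.
have DB : on_line o e1 C c B'.
  split; last by rewrite /side B0 B1 addNr.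
  split; last by rewrite B0.
  by apply: (point_S2 fr); rewrite !sqrrN s2E; move: Csn; lra.
have [k k0 hM] := cone_segment C0 DA.1 DB.1 ler01 ler01 (addr_gt0 ltr01 ltr01).
have DM := segment_cap C0 DA.1 DB.1 hM.
have ME u : dot u (k *: (1 *: A' + 1 *: B')) = k * (dot u A' + dot u B').
  by rewrite dotZr dotDr !dotZr !mul1r.
exists s2, A', B', (k *: (1 *: A' + 1 *: B')); split=> //; split=> //.
  by split=> //; rewrite /side !ME A0 A1 B0 B1; ring.
by rewrite ME A2 B2 subrr mulr0.
Qed.

Definition clears e1 e2 c A B x y := avoids o e1 e2 A B c x y.

Lemma clearsC e1 e2 c A B x y : clears e1 e2 c A B x y -> clears e1 e2 c A B y x.
Proof. by move=> h; rewrite /clears /avoids mulrC => hs q /segmentC; apply: h. Qed.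

(** Reversing [e2] exchanges the two halves; it reduces the lower half to the
    upper one below. *)
Lemma config_mirror e1 e2 c A B : config e1 e2 c A B -> config e1 (- e2) c B A.
Proof.
case=> [[s0 s1 s2 [h1 h2 h3]] hc [LA LB] /andP[hB hA] hAB]; split=> //.
- split=> //; first by move: s2; rewrite /S2 /= dotNl dotNr opprK.
  by rewrite !dotNr h1 h2 h3 oppr0.
- by rewrite !dotNl oppr_lt0 oppr_gt0 hB hA.
- by rewrite sdistC.
Qed.

Lemma clears_mirror e1 e2 c A B x y :
  clears e1 e2 c A B x y -> clears e1 (- e2) c B A x y.
Proof.
move=> h hs q hq q0; case: (h hs q hq q0) => hh; [right|left];
  by rewrite /height !dotNl !mulNr ltrN2.
Qed.

(** An edge in the upper half is at most a leg, whether it stays on one side of the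
    line or passes over [A]. *)
Lemma top_edge_le e1 e2 c A B x y : config e1 e2 c A B -> D x -> D y ->
  0 <= dot e2 x -> 0 <= dot e2 y -> clears e1 e2 c A B x y -> sdist x y <= leg.
Proof.
move=> cfg Dx Dy x2 y2 cl; have [s2 [A' [B' [M [s20 s2E AE BE [LA' LB' LM M2]]]]]] := config_ends cfg.
case: cfg => fr hc [LA LB] /andP[hB hA] hAB.
have [opp|same] := ltP (side o e1 c x * side o e1 c y) 0; last first.
  exact: (quarter_dist fr C0 sn0 Csn sn_small kap0 kap1 hc Dx Dy same (mulr_ge0 x2 y2)).
exact: (around_le_leg fr C0 sn0 Csn sn_small kap0 kap1 hc LA LB hA hB hAB s20 s2E AE BE LB' Dx Dy x2 y2 opp cl).
Qed.

(** The product condition says that the edge does not go from one half to the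
    other. *)
Lemma unsigned_edge_le e1 e2 c A B x y : config e1 e2 c A B -> D x -> D y ->
  0 <= dot e2 x * dot e2 y -> clears e1 e2 c A B x y -> sdist x y <= leg.
Proof.
move=> cfg Dx Dy xy2 cl.
have [x2|x2] := leP 0 (dot e2 x); have [y2|y2] := leP 0 (dot e2 y).
- exact: top_edge_le cl.
- have x0 : dot e2 x = 0 by nra.
  apply: (top_edge_le (config_mirror cfg) Dx Dy _ _ (clears_mirror cl)).
    by rewrite dotNl x0 oppr0.
  by rewrite dotNl oppr_ge0 ltW.
- have y0 : dot e2 y = 0 by nra.
  apply: (top_edge_le (config_mirror cfg) Dx Dy _ _ (clears_mirror cl)).
    by rewrite dotNl oppr_ge0 ltW.
  by rewrite dotNl y0 oppr0.
- apply: (top_edge_le (config_mirror cfg) Dx Dy _ _ (clears_mirror cl));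
    by rewrite dotNl oppr_ge0 ltW.
Qed.

Lemma lone_top_edge e1 e2 c A B x x' y y' : config e1 e2 c A B ->
  D x -> D x' -> D y -> D y' ->
  0 < dot e2 x -> dot e2 x' < 0 -> 0 < dot e2 y -> dot e2 y' < 0 ->
  clears e1 e2 c A B x y -> clears e1 e2 c A B x x' -> clears e1 e2 c A B y y' ->
  sdist x x' <= base -> sdist y y' <= base ->
  sdist x y + sdist x x' <= 2 * leg \/ sdist x y + sdist y y' <= 2 * leg.
Proof.
move=> cfg Dx Dx' Dy Dy' x2 x'2 y2 y'2 cl clx cly hx hy.
have [s2 [A' [B' [M [s20 s2E AE BE [LA' LB' LM M2]]]]]] := config_ends cfg.
case: cfg => fr hc [LA LB] /andP[hB hA] hAB.
have [opp|same] := ltP (side o e1 c x * side o e1 c y) 0.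
  exact: (around_top fr C0 sn0 Csn sn_small kap0 kap1 hc LA LB hA hB hAB s20 s2E AE BE LB' LM M2 Dx Dx' Dy Dy').
have [xy|yx] := leP (dot e2 x) (dot e2 y).
  left; exact: (same_side_top fr C0 sn0 Csn sn_small kap0 kap1 hc LA LB hA hB hAB s20 s2E AE BE LA' LB' LM M2 Dx Dx' Dy).
right; rewrite sdistC.
apply: (same_side_top fr C0 sn0 Csn sn_small kap0 kap1 hc LA LB hA hB hAB s20 s2E AE BE LA' LB' LM M2 Dy Dy' Dx) => //.
  exact: ltW.
by rewrite mulrC.
Qed.

(** If [x y] stays in one half while the edges on both sides of it leave that half,
    it is compensated by one of the two. *)
Lemma lone_edge e1 e2 c A B x x' y y' : config e1 e2 c A B ->
  D x -> D x' -> D y -> D y' ->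
  0 <= dot e2 x * dot e2 y -> dot e2 x * dot e2 x' < 0 -> dot e2 y * dot e2 y' < 0 ->
  clears e1 e2 c A B x y -> clears e1 e2 c A B x x' -> clears e1 e2 c A B y y' ->
  sdist x x' <= base -> sdist y y' <= base ->
  sdist x y + sdist x x' <= 2 * leg \/ sdist x y + sdist y y' <= 2 * leg.
Proof.
move=> cfg Dx Dx' Dy Dy' xy xx' yy' cl clx cly hx hy.
have y0 : dot e2 y != 0 by apply/eqP => e; move: yy'; rewrite e mul0r ltxx.
have [x2|x2|x2] := ltgtP 0 (dot e2 x); last by move: xx'; rewrite -x2 mul0r ltxx.
  have y2 : 0 < dot e2 y by rewrite lt_neqAle eq_sym y0 -(pmulr_rge0 _ x2).
  apply: (lone_top_edge cfg) => //; first by rewrite -(pmulr_rlt0 _ x2).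
  by rewrite -(pmulr_rlt0 _ y2).
have y2 : dot e2 y < 0 by rewrite lt_neqAle y0 -(nmulr_rge0 _ x2).
apply: (lone_top_edge (config_mirror cfg)) => //; try exact: clears_mirror.
- by rewrite dotNl oppr_gt0.
- by rewrite dotNl oppr_lt0 -(nmulr_rlt0 _ x2).
- by rewrite dotNl oppr_gt0.
- by rewrite dotNl oppr_lt0 -(nmulr_rlt0 _ y2).
Qed.

(** The vector [e1] is the part of the normal [cross A B] orthogonal to [o]. It
    does not vanish, since [o] is not orthogonal to [A]. *)
Lemma line_frame A B : D A -> D B -> dot A B < 1 ->
  exists e1 e2 c, [/\ orthonormal o e1 e2, on_line o e1 C c A & on_line o e1 C c B].
Proof.
move=> DA DB AB1; have AB0 := cap_dot_gt0 So C0 Csn sn_small DA DB.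
pose N := cross A B; pose t := N - dot N o *: o.
have So1 : dot o o = 1 := So.
have oA : 0 < dot o A by apply: lt_le_trans DA.2.
have NN : 0 < dot N N.
  have [[SA _] [SB _]] := (DA, DB).
  move: SA SB; rewrite /S2 /= cross_norm => -> ->.
  by rewrite mulr1 subr_gt0 -[ltRHS](expr1n R 2) ltr_pXn2r ?nnegrE // ltW.
have tt : 0 < dot t t.
  rewrite lt_neqAle dot_ge0 andbT; apply/eqP => /esym/dot_eq0 t0.
  have NE : N = dot N o *: o by apply/eqP; rewrite -subr_eq0; apply/eqP.
  have : dot N A = 0 by apply: cross_dotl.
  rewrite NE dotZl => /eqP; rewrite mulf_eq0 (gt_eqF oA) orbF => /eqP No.
  by move: NN; rewrite NE No scale0r -(scale0r o) dotZl mul0r ltxx.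
have [k k0 S1] := normalize tt.
have oe1 : dot o (k *: t) = 0.
  by rewrite dotZr /t dotDr dotNr dotZr So1 mulr1 (dotC o) subrr mulr0.
exists (k *: t), (cross o (k *: t)), (k * dot N o).
split; [exact: (orthonormal_complete So S1 oe1)|split=> //|split=> //].
- by rewrite /side dotZl /t dotDl dotNl dotZl cross_dotl; ring.
- by rewrite /side dotZl /t dotDl dotNl dotZl cross_dotr; ring.
Qed.

(** A line cutting a chord shorter than the base contains no two points of the cap
    at distance the base, which bounds the offset [c]; and [A] and [B] are in
    different halves because the base is longer than a leg. *)
Lemma config_exists A B : D A -> D B -> sdist A B = base ->
  exists e1 e2 c, config e1 e2 c A B.
Proof.
move=> DA DB hAB.
have k01 : 0 <= kap <= 1 by rewrite kap0; move: kap1; lra.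
have ib := cosbase_bounds sn_small k01.
have iAB := S2_dot_bounds DA.1 DB.1.
have dAB : dot A B = cosbase sn kap.
  by rewrite -[LHS](acosK (x := dot A B)) ?in_itv //= -[acos _]/(sdist A B) hAB acosK ?in_itv.
have b1 : cosbase sn kap < 1.
  have : 0 < sn ^+ 2 * (1 - kap ^+ 2).
    by rewrite mulr_gt0 ?exprn_gt0 // subr_gt0 -[ltRHS](expr1n R 2) ltr_pXn2r ?nnegrE //; move: kap1; lra.
  by rewrite /cosbase; lra.
have [e1 [e2 [c [fr LA LB]]]] : exists e1 e2 c,
    [/\ orthonormal o e1 e2, on_line o e1 C c A & on_line o e1 C c B].
  by apply: line_frame; rewrite ?dAB.
have hc2 : (c * C) ^+ 2 <= (kap * sn) ^+ 2.
  have cA := S2_coords fr DA.1; have cB := S2_coords fr DB.1.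
  move: dAB; rewrite (frame_dot fr) /cosbase.
  rewrite (side0 LA.2) in cA *; rewrite (side0 LB.2) in cB *.
  rewrite sqrrN exprMn in cA; rewrite sqrrN exprMn in cB.
  have := DA.2; have := DB.2; rewrite !exprMn.
  set a := dot o A in cA *; set b := dot o B in cB *.
  set a2 := dot e2 A in cA *; set b2 := dot e2 B in cB * => hb ha.
  have aa : C ^+ 2 <= a ^+ 2 by rewrite ler_pXn2r ?nnegrE // ltW // (lt_le_trans C0).
  have bb : C ^+ 2 <= b ^+ 2 by rewrite ler_pXn2r ?nnegrE // ltW // (lt_le_trans C0).
  have ab : C ^+ 2 <= a * b by rewrite expr2; apply: ler_pM => //; exact: ltW.
  have cc := sqr_ge0 c.
  have caa : c ^+ 2 * C ^+ 2 <= c ^+ 2 * a ^+ 2 by rewrite ler_wpM2l.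
  have cbb : c ^+ 2 * C ^+ 2 <= c ^+ 2 * b ^+ 2 by rewrite ler_wpM2l.
  have cab : c ^+ 2 * C ^+ 2 <= c ^+ 2 * (a * b) by rewrite ler_wpM2l.
  have sq := sqr_ge0 (a2 + b2).
  have e : (a2 + b2) ^+ 2 = a2 ^+ 2 + b2 ^+ 2 + 2 * (a2 * b2) by ring.
  move=> E; have {E} : a * b + c ^+ 2 * (a * b) + a2 * b2 = 1 - 2 * sn ^+ 2 * (1 - kap ^+ 2).
    by rewrite -E; ring.
  by move: Csn; lra.
have hc : - (kap * sn) <= c * C <= kap * sn.
  by apply: sqr_le_bounds hc2; rewrite mulr_ge0 // ltW.
have signs : dot e2 A * dot e2 B < 0.
  rewrite ltNge; apply/negP => h.
  have := leg_lt_base sn0 sn_small kap0 kap1.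
  rewrite ltNge -/base -hAB => /negP; apply.
  by apply: (quarter_dist fr C0 sn0 Csn sn_small kap0 kap1 hc DA DB) => //; rewrite LA.2 mul0r.
have [a2|a2] := ltP 0 (dot e2 A).
  exists e1, e2, c; split=> //; rewrite a2 andbT.
  by rewrite -(pmulr_rlt0 _ a2).
exists e1, (- e2), c; split=> //.
  case: fr => s0 s1 s2 [h1 h2 h3]; split=> //; first by move: s2; rewrite /S2 /= dotNl dotNr opprK.
  by rewrite !dotNr h1 h2 h3 oppr0.
have a2' : dot e2 A < 0.
  by rewrite lt_neqAle a2 andbT; apply/eqP => e; move: signs; rewrite e mul0r ltxx.
by rewrite !dotNl oppr_lt0 oppr_gt0 a2' andbT -(nmulr_rlt0 _ a2').
Qed.

End Config.

(** * Simple polygons with an odd number of edges *)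

Section Polygon.
Variables (R : realType) (n : nat) (v : 'I_n -> 'rV[R]_3).
Implicit Types (i j k h : 'I_n).
Hypotheses (n3 : (3 <= n)%N) (simple : simple_polygon v).

Lemma ordS_neq i : ordS i != i.
Proof.
apply/eqP => /(congr1 val) /=; have in_ := ltn_ord i.
have [lt|ge] := ltnP i.+1 n; first by rewrite modn_small // => /esym/n_Sn.
have -> : i.+1 = n by apply/eqP; rewrite eqn_leq ge andbT.
by rewrite modnn => i0; move: ge; rewrite -i0 leqNgt (leq_trans _ n3).
Qed.

Lemma ord_pred_neq i : ord_pred i != i.
Proof. by rewrite eq_sym -{1}(ord_predK i) ordS_neq. Qed.

Lemma edge_start i : edge v i (v i).
Proof.
split; first by case: simple => /(_ i)[].
by exists 1, 0; rewrite scale1r scale0r addr0.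
Qed.

Lemma edge_end i : edge v i (v (ordS i)).
Proof.
split; first by case: simple => /(_ (ordS i))[].
by exists 0, 1; rewrite scale1r scale0r add0r.
Qed.

(** A point on two edges is a vertex, and a vertex lies on no edge besides the two
    that are incident to it. *)
Lemma edges_meet i j z : i != j -> edge v i z -> edge v j z ->
  z = v i \/ z = v (ordS i).
Proof.
move=> ij zi zj; case: simple => _ deg reg.
have two k : #|[set k; ord_pred k]%SET| = 2%N by rewrite cards2 eq_sym ord_pred_neq.
have [[k zk]|no] := pselect (exists k, z = v k); last first.
  have /reg : forall k, z <> v k by move=> k zk; apply: no; exists k.
  rewrite leqNgt => /negP[]; apply: leq_trans (_ : #|[set i; j]%SET| <= _)%N.
    by rewrite cards2 ij.
  rewrite /nb_edges_at; apply: subset_leq_card.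
  by apply/fintype.subsetP => k; rewrite in_set2 unfold_in /= => /orP[/eqP ->|/eqP ->]; apply/asboolP.
have sub : [set k; ord_pred k]%SET \subset [pred l | `[< edge v l (v k) >]].
  apply/fintype.subsetP => l; rewrite in_set2 unfold_in /= => /orP[/eqP ->|/eqP ->]; apply/asboolP.
    exact: edge_start.
  by rewrite -{2}(ord_predK k); apply: edge_end.
have eqs : [set k; ord_pred k]%SET =i [pred l | `[< edge v l (v k) >]].
  by apply/subset_cardP => //; rewrite two -[RHS]/(nb_edges_at v (v k)) deg.
have : i \in [set k; ord_pred k]%SET by rewrite eqs unfold_in /=; apply/asboolP; rewrite -zk.
by rewrite in_set2 zk => /orP[/eqP ->|/eqP ->]; [left|right; rewrite ord_predK].
Qed.

(** Around a closed polygon the sign of a function on the vertices changes an even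
    number of times: the product of all [a i * a (ordS i)] is a square. *)
Lemma unsigned_edge (a : 'I_n -> R) : odd n -> exists i, 0 <= a i * a (ordS i).
Proof.
move=> on; apply: contrapT => no.
have neg i : 0 < - (a i * a (ordS i)).
  by rewrite oppr_gt0 ltNge; apply/negP => h; apply: no; exists i.
have : 0 < \prod_i - (a i * a (ordS i)) by apply: prodr_gt0 => i _.
have cyc : \prod_i a (ordS i) = \prod_i a i by rewrite [RHS](reindex_inj (@ordS_inj n)).
rewrite prodrN big_split /= cyc card_ord -signr_odd on.
by rewrite expr1 mulN1r oppr_gt0 -expr2 ltNge sqr_ge0.
Qed.

Variables (o : 'rV[R]_3) (C sn kap : R).
Hypotheses (So : S2 o) (C0 : 0 < C) (sn0 : 0 < sn).
Hypotheses (Csn : C ^+ 2 + sn ^+ 2 = 1) (sn_small : sn ^+ 2 <= 1 / 100).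
Hypotheses (kap0 : 0 <= kap) (kap1 : kap <= 49 / 100).
Hypothesis inC : forall i, cap o C (v i).

(** A crossing of the line between [A] and [B] would be a point of the longest
    edge, hence an endpoint of the other edge, which lies off the line. *)
Lemma edge_clears e1 e2 c h i : config o C sn kap e1 e2 c (v h) (v (ordS h)) ->
  clears o e1 e2 c (v h) (v (ordS h)) (v i) (v (ordS i)).
Proof.
case=> fr hc [LA LB] /andP[B2 A2] hAB opp q qi q0.
have ih : i != h.
  by apply/eqP => e; move: opp; rewrite e LA.2 mul0r ltxx.
have Lq : on_line o e1 C c q by split=> //; apply: (segment_cap C0 (inC i) (inC (ordS i))).
have [|hA] := ltP (height o e2 (v h)) (height o e2 q); first by left.
have [|hB] := ltP (height o e2 q) (height o e2 (v (ordS h))); first by right.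
have qh : edge v h q.
  apply: (line_between fr C0 Lq LA LB hB hA).
  by apply: lt_trans (_ : _ < 0) _; rewrite ?(height_lt0 _ C0 LB.1) ?(height_gt0 _ C0 LA.1).
by case: (edges_meet ih qi qh) => e; move: opp; rewrite -e q0 ?mul0r ?mulr0 ltxx.
Qed.

(** By parity some edge stays in one half. If two edges do, each is at most a leg;
    if only one does, both of its neighbours change halves and [lone_edge]
    applies. *)
Lemma short_pair h : odd n ->
  (forall i, sdist (v i) (v (ordS i)) <= sdist (v h) (v (ordS h))) ->
  sdist (v h) (v (ordS h)) = acos (cosbase sn kap) ->
  exists i j, i != j /\ sdist (v i) (v (ordS i)) + sdist (v j) (v (ordS j)) <=
    2 * acos (cosleg sn kap).
Proof.
move=> on longest hE.
have [e1 [e2 [c cfg]]] :=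
  config_exists So C0 sn0 Csn sn_small kap0 kap1 (inC h) (inC (ordS h)) hE.
have cl i := edge_clears (i := i) cfg.
have [i bi] := unsigned_edge (fun i => dot e2 (v i)) on.
have short j : 0 <= dot e2 (v j) * dot e2 (v (ordS j)) ->
    sdist (v j) (v (ordS j)) <= acos (cosleg sn kap).
  move=> bj; exact: (unsigned_edge_le C0 sn0 Csn sn_small kap0 kap1 cfg (inC j) (inC (ordS j)) bj (cl j)).
have [[j ij bj]|one] := pselect (exists2 j, i != j & 0 <= dot e2 (v j) * dot e2 (v (ordS j))).
  exists i, j; split=> //.
  by rewrite mulr_natl mulr2n; apply: lerD; apply: short.
have neg j : i != j -> dot e2 (v j) * dot e2 (v (ordS j)) < 0.
  by move=> ij; rewrite ltNge; apply/negP => bj; apply: one; exists j.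
have ip : i != ord_pred i by rewrite eq_sym ord_pred_neq.
have iS : i != ordS i by rewrite eq_sym ordS_neq.
have np := neg _ ip; have cp := cl (ord_pred i); have lp := longest (ord_pred i).
rewrite ord_predK in np cp lp.
rewrite mulrC in np; rewrite sdistC hE in lp.
have lS := longest (ordS i); rewrite hE in lS.
case: (lone_edge C0 sn0 Csn sn_small kap0 kap1 cfg (inC i) (inC (ord_pred i)) (inC (ordS i))
  (inC (ordS (ordS i))) bi np (neg _ iS) (cl i) (clearsC cp) (cl (ordS i)) lp lS) => hle.
  by exists i, (ord_pred i); split=> //; rewrite ord_predK (sdistC (v (ord_pred i))).
by exists i, (ordS i).
Qed.

End Polygon.

(** * Small radii and inscribed triangles *)

Section SmallRadius.
Variables (R : realType) (rho : R).
Hypotheses (rho0 : 0 < rho) (rho_small : rho < 1 / 20).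
Implicit Types t : R.

Lemma sin_le t : 0 <= t -> sin t <= t.
Proof.
move=> t0.
have [c _] := MVT_segment (f := sin) (df := cos) t0
  (fun x _ => is_derive_sin x) (continuous_subspaceT (@continuous_sin R)).
rewrite sin0 !subr0 => ->.
by rewrite -[leRHS]mul1r ler_wpM2r // cos_le1.
Qed.

Lemma cos_double t : cos (2 * t) = 1 - 2 * sin t ^+ 2.
Proof. by rewrite mulr_natl cos_mulr2n cos2sin2 -mulr_natl; ring. Qed.

Lemma sin_ge t : 0 <= t <= 1 / 20 -> 997 / 1000 * t <= sin t.
Proof.
move=> /andP[t0 t1].
have [c] := MVT_segment (f := sin) (df := cos) t0
  (fun x _ => is_derive_sin x) (continuous_subspaceT (@continuous_sin R)).
rewrite in_itv /= => /andP[c0 ct]; rewrite sin0 !subr0 => ->.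
apply: ler_wpM2r => //.
have -> : c = 2 * (c / 2) by lra.
have h0 : 0 <= c / 2 by lra.
have h1 : c / 2 <= 1 / 20 by lra.
have pi2 := pi_ge2 R.
have s0 : 0 <= sin (c / 2) by apply: sin_ge0_pi; lra.
have : sin (c / 2) ^+ 2 <= (1 / 40) ^+ 2.
  by rewrite ler_pXn2r ?nnegrE ?divr_ge0 //; have := sin_le h0; lra.
by rewrite cos_double; lra.
Qed.

Let rho_pi : rho \in `[0, pi].
Proof. by have := pi_ge2 R; move: rho0 rho_small; rewrite in_itv /=; lra. Qed.

Lemma cos_rho_gt0 : 0 < cos rho.
Proof. by apply: cos_gt0_pihalf; have := pihalf_ge1 R; move: rho0 rho_small; lra. Qed.

Lemma sin_rho_gt0 : 0 < sin rho.
Proof. by apply: sin_gt0_pi; have := pi_ge2 R; move: rho0 rho_small; lra. Qed.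

Lemma sin_rho_small : sin rho ^+ 2 <= 1 / 100.
Proof.
have s0 := sin_rho_gt0; have := sin_le (ltW rho0); move: rho0 rho_small => h1 h2 h3.
by rewrite expr2; nra.
Qed.

Lemma disk_cap (o x : 'rV[R]_3) : S2 o -> disk o rho x -> cap o (cos rho) x.
Proof.
move=> So [Sx h]; split=> //; apply: acos_le_inv; last by rewrite cosK.
- by rewrite cos_geN1 cos_le1.
- exact: S2_dot_bounds.
Qed.

(** For small radii the angles compare as their sines do: with [k] at least
    [49 / 100] the base is at most [1.75 * rho], whereas for [k = 0] the base is
    [2 * rho] and a leg is at least [1.4 * rho]; and [5 * 1.75] is less than
    [3 * 2 + 2 * 1.4]. *)
Lemma long_base (k : R) : 49 / 100 <= k -> k <= 1 ->
  5 * acos (cosbase (sin rho) k) <= 3 * acos (cosbase (sin rho) 0) + 2 * acos (cosleg (sin rho) 0).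
Proof.
move=> k0 k1; have pi2 := pi_ge2 R; move: rho0 rho_small => r0 r1.
have s0 := sin_rho_gt0; have s1 := sin_le (ltW r0); have s2 := sin_rho_small.
have s3 : 997 / 1000 * rho <= sin rho by apply: sin_ge; lra.
have acos_cos t : 0 <= t -> t <= 1 -> acos (cos t) = t.
  by move=> h1 h2; rewrite cosK // in_itv /= h1; lra.
have sq (a b : R) : 0 <= a -> a <= b -> a ^+ 2 <= b ^+ 2.
  by move=> a0 ab; rewrite !expr2 ler_pM.
have base0 : acos (cosbase (sin rho) 0) = 2 * rho.
  rewrite -[RHS]acos_cos; [|lra|lra]; congr acos.
  by rewrite cos_double /cosbase; ring.
have leg0 : 14 / 10 * rho <= acos (cosleg (sin rho) 0).
  have /andP[l0 l1] : 1 / 2 <= cosleg (sin rho) 0 <= 1 by apply: cosleg_bounds => //; lra.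
  rewrite -[leLHS]acos_cos; [|lra|lra]; apply: le_acos; [lra| |exact: cos_le1].
  have -> : 14 / 10 * rho = 2 * (7 / 10 * rho) by lra.
  have h0 : 0 <= 7 / 10 * rho by lra.
  have := sin_le h0; have : 0 <= sin (7 / 10 * rho) by apply: sin_ge0_pi; lra.
  by rewrite cos_double /cosleg; nra.
have basek : acos (cosbase (sin rho) k) <= 175 / 100 * rho.
  have /andP[b0 b1] : -1 <= cosbase (sin rho) k <= 1 by apply: cosbase_bounds => //; lra.
  rewrite -[leRHS]acos_cos; [|lra|lra]; apply: le_acos => //; first exact: cos_geN1.
  have -> : 175 / 100 * rho = 2 * (875 / 1000 * rho) by lra.
  have : 997 / 1000 * (875 / 1000 * rho) <= sin (875 / 1000 * rho) by apply: sin_ge; lra.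
  rewrite cos_double /cosbase; move: (sin (875 / 1000 * rho)) => z hz.
  have h1 : (997 / 1000 * (875 / 1000 * rho)) ^+ 2 <= z ^+ 2.
    by apply: sq; [lra|exact: hz].
  have h2 := sq _ _ (ltW s0) s1.
  have h3 := sq _ _ (divr_ge0 (ler0n _ 49) (ler0n _ 100)) k0.
  have h4 : sin rho ^+ 2 * (49 / 100) ^+ 2 <= sin rho ^+ 2 * k ^+ 2.
    by rewrite ler_wpM2l // sqr_ge0.
  by have := sqr_ge0 rho; rewrite !exprMn in h1 *; lra.
by rewrite base0; lra.
Qed.

(** Moving from [x] away from the centre along a great circle leaves the disk at
    once. *)
Lemma circle_boundary (o x : 'rV[R]_3) : S2 o -> S2 x -> dot o x = cos rho ->
  sboundary (disk o rho) x.
Proof.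
move=> So Sx ox; have s0 := sin_rho_gt0; split.
  by apply: subset_closure; split=> //; rewrite /sdist ox cosK.
have So1 : dot o o = 1 := So; have Sx1 : dot x x = 1 := Sx.
have sn0 : sin rho != 0 by rewrite gt_eqF.
have cs := cos2Dsin2 rho.
have [y [xy oy yy]] : exists y, [/\ dot x y = 0, dot o y = - sin rho & dot y y = 1].
  have xu : dot x (cos rho *: x - o) = 0.
    by rewrite dotDr dotNr dotZr Sx1 (dotC x) ox mulr1 subrr.
  have ou : dot o (cos rho *: x - o) = - (sin rho ^+ 2).
    by rewrite dotDr dotNr dotZr ox So1 -cs; ring.
  exists ((sin rho)^-1 *: (cos rho *: x - o)).
  rewrite dotZl !dotZr dotDl dotNl dotZl xu ou; split; first by rewrite mulr0.
    by field.
  by field.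
pose g t : 'rV[R]_3 := cos t *: x + sin t *: y.
have Sg t : S2 (g t).
  rewrite /S2 /= /g dotDl !dotDr !dotZl !dotZr Sx1 yy (dotC y) xy.
  by rewrite -[RHS](cos2Dsin2 t); ring.
have og t : dot o (g t) = cos (rho + t) by rewrite dotDr !dotZr ox oy cosD; ring.
have g0 : g 0 = x by rewrite /g cos0 sin0 scale1r scale0r addr0.
have cg : g t @[t --> 0^'+] --> x.
  rewrite -g0; apply: cvg_at_right_filter; apply: cvgD; apply: cvgZr_tmp;
    [exact: continuous_cos|exact: continuous_sin].
move=> B /cg nB.
have [t [Bt /andP[t0 t1]]] : exists t, B (g t) /\ 0 < t < 1.
  near (0 : R)^'+ => t; exists t; split; first by near: t.
  apply/andP; split; near: t; [exact: nbhs_right_gt|].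
  by apply: nbhs_right_lt; rewrite ltr01.
exists (g t); split=> //; split; first exact: Sg.
case=> _; rewrite /sdist og cosK ?in_itv /=; last first.
  by have := pi_ge2 R; move: rho0 rho_small; lra.
by rewrite leNgt ltrDl t0.
Unshelve. all: by end_near. Qed.

Lemma inscribed_isosceles (o : 'rV[R]_3) (k : R) : S2 o -> 0 <= k <= 1 / 2 ->
  exists a b c : 'rV[R]_3, [/\ triangle a b c, inscribed a b c (disk o rho) &
    [/\ sdist a b = acos (cosbase (sin rho) k), sdist b c = acos (cosleg (sin rho) k) &
        sdist c a = acos (cosleg (sin rho) k)]].
Proof.
move=> So /andP[k0 k1]; have s0 := sin_rho_gt0; have cs := cos2Dsin2 rho.
have [e1 [e2 fr]] := frame_exists So.
pose w := Num.sqrt (1 - k ^+ 2).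
have k2 : 0 < 1 - k ^+ 2 by rewrite subr_gt0 expr_lt1 //; lra.
have w0 : 0 < w by rewrite sqrtr_gt0.
have wE : w ^+ 2 = 1 - k ^+ 2 by rewrite sqr_sqrtr // ltW.
pose C := cos rho; pose sn := sin rho.
have circle x y : x ^+ 2 + y ^+ 2 = 1 ->
    let p := point o e1 e2 C (sn * x) (sn * y) in
    [/\ S2 p, sboundary (disk o rho) p, dot o p = C, dot e1 p = sn * x & dot e2 p = sn * y].
  move=> xy p; have [p0 p1 p2] := point_coords fr C (sn * x) (sn * y).
  have Sp : S2 p.
    by apply: (point_S2 fr); rewrite -addrA !exprMn -mulrDr xy mulr1.
  by split=> //; apply: circle_boundary.
have ea : (- k) ^+ 2 + w ^+ 2 = 1 by rewrite wE; ring.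
have eb : (- k) ^+ 2 + (- w) ^+ 2 = 1 by rewrite !sqrrN wE; ring.
have ec : 1 ^+ 2 + 0 ^+ 2 = 1 :> R by ring.
have [Sa Ba a0 a1 a2] := circle _ _ ea; have [Sb Bb b0 b1 b2] := circle _ _ eb.
have [Sc Bc c0 c1 c2] := circle _ _ ec.
set a := point o e1 e2 C _ _ in Sa Ba a0 a1 a2.
set b := point o e1 e2 C _ _ in Sb Bb b0 b1 b2.
set c := point o e1 e2 C _ _ in Sc Bc c0 c1 c2.
exists a, b, c; split=> //.
- split=> // u; rewrite !(frame_dot fr u) a0 a1 a2 b0 b1 b2 c0 c1 c2 => ua ub uc.
  have sn0 : sn != 0 by rewrite gt_eqF.
  have wn : w != 0 by rewrite gt_eqF.
  have C0 : C != 0 by rewrite gt_eqF // cos_rho_gt0.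
  have kn : 1 + k != 0 by rewrite gt_eqF //; lra.
  have u2 : dot e2 u = 0.
    apply: (mulIf (mulf_neq0 sn0 wn)); rewrite mul0r; move: ua ub; lra.
  have u1 : dot e1 u = 0.
    apply: (mulIf (mulf_neq0 sn0 kn)); rewrite mul0r.
    by move: ua ub uc; rewrite u2; lra.
  have u0 : dot o u = 0.
    by apply: (mulIf C0); rewrite mul0r; move: uc; rewrite u1; lra.
  by apply: dot_eq0; rewrite (frame_dot fr) u0 u1 u2; ring.
- rewrite /sdist (frame_dot fr a) (frame_dot fr b) (frame_dot fr c) a0 a1 a2 b0 b1 b2 c0 c1 c2.
  have CE : C ^+ 2 = 1 - sn ^+ 2 by rewrite -cs addrK.
  have e3 : C * C + sn * - k * (sn * - k) + sn * w * (sn * - w) = cosbase sn k.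
    transitivity (C ^+ 2 + sn ^+ 2 * k ^+ 2 - sn ^+ 2 * w ^+ 2); first by ring.
    by rewrite CE wE /cosbase; ring.
  have e4 (y : R) : C * C + sn * - k * (sn * 1) + y * (sn * 0) = cosleg sn k.
    transitivity (C ^+ 2 - sn ^+ 2 * k); first by ring.
    by rewrite CE /cosleg; ring.
  split; congr acos; [exact: e3|exact: e4|rewrite -(e4 0); ring].
Qed.

End SmallRadius.

(** * The perimeter *)

Section Perimeter.
Variables (R : realType) (n : nat).
Implicit Types (d : 'I_n -> R) (m : R).

Lemma sum_le_const d m : (forall i, d i <= m) -> \sum_i d i <= n%:R * m.
Proof.
move=> h; apply: le_trans (ler_sum _ (fun i _ => h i)) _.
by rewrite sumr_const card_ord mulr_natl.
Qed.

Lemma sum_le_pair d m (b : R) (i j : 'I_n) : i != j -> (forall i, d i <= m) ->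
  d i + d j <= 2 * b -> \sum_i d i <= (n - 2)%:R * m + 2 * b.
Proof.
move=> ij h hij.
have ji : j != i by rewrite eq_sym.
have n2 : (2 <= n)%N by have := max_card (mem [set i; j]%SET); rewrite cards2 ij card_ord.
have : 0 <= \sum_(k | (k != i) && (k != j)) (m - d k).
  by apply: sumr_ge0 => k _; rewrite subr_ge0.
have e : \sum_k (m - d k) = n%:R * m - \sum_k d k.
  by rewrite sumrB sumr_const card_ord mulr_natl.
rewrite (bigD1 i) //= (bigD1 j) //= in e.
rewrite natrB // => h1; move: e h1 hij; set t := bigop.body _ _ _; set r := bigop.body _ _ _.
by rewrite mulrBl; lra.
Qed.

End Perimeter.

Lemma ordS_three m (i : 'I_m) : m = 3 -> ordS (ordS (ordS i)) = i.
Proof. by move=> m3; subst m; apply: val_inj; case: i => [[|[|[|]]]]. Qed.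

Section Polygons.
Variables (R : realType) (n : nat) (v : 'I_n -> 'rV[R]_3) (rho : R) (o : 'rV[R]_3).
Hypotheses (on : odd n) (n3 : (3 <= n)%N) (simple : simple_polygon v).
Hypotheses (rho0 : 0 < rho) (rho_small : rho < 1 / 20).
Hypotheses (So : S2 o) (inD : polygon_curve v `<=` disk o rho).

Let len i := sdist (v i) (v (ordS i)).
Let base k := acos (cosbase (sin rho) k).
Let leg k := acos (cosleg (sin rho) k).

Let C0 := cos_rho_gt0 rho0 rho_small.
Let sn0 := sin_rho_gt0 rho0 rho_small.
Let sn_small := sin_rho_small rho0 rho_small.
Let Csn := cos2Dsin2 rho.

Let inC i : cap o (cos rho) (v i).
Proof. by apply: (disk_cap rho0 rho_small So); apply: inD; exists i => //; apply: edge_start. Qed.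

(** For a triangle the two shorter sides are bounded directly by [legs_le], for
    every parameter. *)
Lemma pair_le (h : 'I_n) k : 0 <= k <= 1 / 2 -> (n = 3 \/ k <= 49 / 100) ->
  (forall i, len i <= len h) -> len h = base k ->
  exists i j, i != j /\ len i + len j <= 2 * leg k.
Proof.
move=> /andP[k0 k2] [n3'|k1] longest hk; last first.
  exact: (short_pair n3 simple So C0 sn0 Csn sn_small k0 k1 inC on longest hk).
exists (ordS h), (ordS (ordS h)); split; first by rewrite eq_sym ordS_neq.
have hS := ordS_three h n3'.
rewrite addrC /len hS (sdistC (v (ordS h))).
have k01 : 0 <= k <= 1 by rewrite k0; lra.
apply: (legs_le So C0 Csn sn_small (inC h) (inC (ordS h)) (inC (ordS (ordS h))) k01).
by rewrite -[leLHS]hk.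
Qed.

(** The parameter [k] is the one for which the base is the longest edge, except in
    two cases. If the longest edge is at most the side of the inscribed
    equilateral triangle, then [k = 1 / 2] bounds every edge by that side. If
    the longest edge is slightly longer than this side, [pair_le] may not apply
    when there are at least five edges; but then [k = 0] does, because
    three times the excess of the diameter over the longest edge outweighs
    twice the amount by which the legs fall short of that edge. *)
Lemma perim_le : exists2 k, 0 <= k <= 1 / 2 &
  perim v <= (n - 2)%:R * base k + 2 * leg k.
Proof.
pose S := sin rho ^+ 2.
have S0 : 0 < S by rewrite exprn_gt0.
have i0 : 'I_n by case: (n) n3 => // m _; exact: ord0.
have [h longest] : exists h, forall i, len i <= len h.
  by case: (Order.TotalTheory.arg_maxP len (isT : xpredT i0)) => h _ hh; exists h => i; apply: hh.
have nE m : n%:R * m = (n - 2)%:R * m + 2 * m :> R by rewrite -mulrDl -natrD subnK // ltnW.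
set d := dot (v h) (v (ordS h)).
have /andP[d1 d2] := S2_dot_bounds (inC h).1 (inC (ordS h)).1.
rewrite -/d in d1 d2.
have [short|long] := leP (1 - 3 / 2 * S) d.
  exists (1 / 2); first lra.
  have -> : leg (1 / 2) = base (1 / 2) by congr acos; rewrite /cosleg /cosbase; field.
  rewrite -nE; apply: sum_le_const => i; apply: le_trans (longest i) _.
  apply: le_acos d2; rewrite /cosbase -/S; last by lra.
  by move: sn_small; rewrite -/S; lra.
have dS : 1 - 2 * S <= d := cap_dot_diameter So C0 Csn (inC h) (inC (ordS h)).
have q0 : 0 <= 1 - (1 - d) / (2 * S).
  by rewrite subr_ge0 ler_pdivrMr ?mul1r; lra.
pose k := Num.sqrt (1 - (1 - d) / (2 * S)).
have kE : k ^+ 2 = 1 - (1 - d) / (2 * S) by rewrite sqr_sqrtr.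
have k0 : 0 <= k := sqrtr_ge0 _.
have dE : d = cosbase (sin rho) k.
  by rewrite /cosbase -/S kE; field; rewrite gt_eqF.
have k2 : k <= 1 / 2.
  rewrite leNgt; apply/negP => k2.
  have : (1 / 2) ^+ 2 < k ^+ 2 by rewrite ltr_pXn2r ?nnegrE ?divr_ge0.
  by move: long; rewrite dE /cosbase -/S; nra.
have hk : len h = base k by rewrite /len /sdist -/d dE.
have [k1|k1] := leP k (49 / 100); last have [n3'|n3'] := eqVneq n 3%N.
- have [i [j [ij hij]]] := pair_le (introT andP (conj k0 k2)) (or_intror k1) longest hk.
  exists k; first by rewrite k0.
  by apply: (sum_le_pair ij) hij => l; rewrite -hk.
- have [i [j [ij hij]]] := pair_le (introT andP (conj k0 k2)) (or_introl n3') longest hk.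
  exists k; first by rewrite k0.
  by apply: (sum_le_pair ij) hij => l; rewrite -hk.
have n5 : (5 <= n)%N by move: n3 n3' on; clear; case: n => [|[|[|[|[|]]]]].
exists 0; first lra.
have kk1 : k <= 1 by lra.
have h5 := long_base rho0 rho_small (ltW k1) kk1.
have hb : base k <= base 0.
  apply: le_acos.
  - by have /andP[] := cosbase_bounds sn_small (introT andP (conj (lexx 0) ler01)).
  - by rewrite /cosbase -/S expr0n /=; have := mulr_ge0 (ltW S0) (sqr_ge0 k); lra.
  - by rewrite -dE.
apply: le_trans (sum_le_const (m := base k) _) _; first by move=> i; rewrite -hk; exact: longest.
have -> : n%:R = (n - 5)%:R + 5 :> R by rewrite -natrD subnK.
have -> : (n - 2)%:R = (n - 5)%:R + 3 :> R by rewrite -natrD -[5%N]/(2 + 3)%N subnDA subnK // ltn_subRL.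
have := ler_wpM2l (ler0n R (n - 5)) hb; rewrite -/(base k) -/(base 0) -/(leg 0) in h5.
by rewrite !mulrDl; move: h5; lra.
Qed.

End Polygons.

Theorem mainTheorem2 (R : realType) :
  exists eps : R, 0 < eps /\
    forall (n : nat) (rho : R), odd n -> (3 <= n)%N -> 0 < rho < eps ->
    forall (o : 'rV[R]_3) (v : 'I_n -> 'rV[R]_3),
      S2 o -> simple_polygon v -> polygon_curve v `<=` disk o rho ->
      exists (a b c : 'rV[R]_3) (alpha beta : R),
        [/\ triangle a b c,
            inscribed a b c (disk o rho),
            [/\ sdist a b = alpha, sdist b c = beta & sdist c a = beta],
            beta <= alpha &
            perim v <= (n - 2)%:R * alpha + 2 * beta].
Proof.
exists (1 / 20); split; first lra.
move=> n rho on n3 /andP[rho0 rho_small] o v So simple inD.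
have [k k02 perim_k] := perim_le on n3 simple rho0 rho_small So inD.
have [a [b [c [tri ins lengths]]]] := inscribed_isosceles rho0 rho_small So k02.
exists a, b, c, (acos (cosbase (sin rho) k)), (acos (cosleg (sin rho) k)); split=> //.
have sn_small := sin_rho_small rho0 rho_small.
have k01 : 0 <= k <= 1 by lra.
have /andP[b1 _] := cosbase_bounds sn_small k01; have /andP[_ l1] := cosleg_bounds sn_small k01.
apply: le_acos => //; rewrite /cosbase /cosleg -subr_ge0.
rewrite [X in 0 <= X](_ : _ = sin rho ^+ 2 * ((1 + k) * (1 - 2 * k))); last by ring.
by apply: mulr_ge0; [exact: sqr_ge0|apply: mulr_ge0; lra].
Qed.
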